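(* Let $\vartheta\in(0,\pi)$ be fixed and suppose that $\tau$ satisfies the nonresonance condition $\bigl|\tau\|B\|-2\pi k\bigr|\ge\vartheta$ for all $k\in\mathbb Z\setminus\{0\}$, and that $\tau\|B\|\ge\vartheta_0$ for a given $\vartheta_0\in(0,1)$. Assume that the filter functions are chosen such that $\Phi_0=\Psi_0=\Psi_1=0$ and $\Phi_1(0)=0$, and that a constant $C_{\mathbf S}$ exists such that $\|\mathbf S\|\le C_{\mathbf S}$. Moreover, let $L_E$ be the Lipschitz constant of $E$ and let $\tau$ be sufficiently small such that $2\tau(1+T)L_EC_{\mathbf S}<1$. Then for $0\le t_n=n\tau\le T$ the errors $e_{q,n}=q(t_n)-q_n$ and $e_{v,n}=v(t_n)-v_n$ of the exponential integrator satisfy $$\|e_{q,n}\|=\mathcal O(\tau^2),\qquad \|P_\parallel e_{v,n}\|=\mathcal O(\tau^2),\qquad \|P_\perp e_{v,n}\|=\mathcal O(\tau).$$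
   Context: Setting. $B\in\mathbb R^3$ is a constant strong magnetic field, $\|B\|=1/\delta\gg1$, and $\mathbf B\in\mathbb R^{3\times 3}$ is the skew-symmetric matrix with $\mathbf B v=v\times B$ (eigenvalues $0,\pm i\|B\|$). $P_\parallel$ is the orthogonal projection onto $\mathrm{span}(B)$, $P_\perp=\mathrm{Id}-P_\parallel$. $E:\mathbb R^3\to\mathbb R^3$ is the electric field and $(q,v)$ is the solution on $[0,T]$ of $$\dot q=v,\qquad \dot v=v\times B+E(q),\qquad q(0)=q_0,\ v(0)=v_0 .$$ Assumption: the trajectories of $q,v$ remain in compact sets $K_q,K_v$ independent of $\|B\|$, and $E\in C^2$ in a neighborhood of $K_q$. Integrator. For a stepsize $\tau>0$, $t_n=n\tau$, $E_n=E(q_n)$, the approximations $q_n\approx q(t_n)$, $v_n\approx v(t_n)$ start from $q_0,v_0$ and satisfy $$q_{n+1}=q_n+\tfrac\tau2\bigl(\psi_-(\tau\mathbf B)v_n+\psi_+(\tau\mathbf B)v_{n+1}\bigr)+\tfrac{\tau^2}4\bigl(\chi_-(\tau\mathbf B)E_n+\chi_+(\tau\mathbf B)E_{n+1}\bigr),$$ $$v_{n+1}=e^{\tau\mathbf B}v_n+\tfrac\tau2\bigl(\phi_-(\tau\mathbf B)E_n+\phi_+(\tau\mathbf B)E_{n+1}\bigr),$$ with given filter functions $\psi_\pm,\chi_\pm,\phi_\pm$ defined on the eigenvalues $0,\pm i\tau\|B\|$ of $\tau\mathbf B$. Notation. $\varphi_k(z)=\int_0^1e^{(1-\sigma)z}\frac{\sigma^{k-1}}{(k-1)!}d\sigma$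 for $k\ge1$, $\operatorname{sinch}(z)=\sinh(z)/z$, $\psi_{1,\sinh}(z)=(\sinh z-z)/z^2$ (both extended continuously to $z=0$), $$\Phi_0=\varphi_1-\tfrac12(\phi_++\phi_-),\qquad \Phi_1=\varphi_2-\tfrac12\varphi_1-\tfrac14(\phi_+-\phi_-),$$ $$\Psi_0(z)=\operatorname{sinch}(\tfrac z2)-\tfrac12\bigl(\psi_-(z)+\psi_+(z)e^z\bigr)e^{-z/2},$$ $$\Psi_1(z)=\tfrac12\psi_{1,\sinh}(\tfrac z2)-\tfrac14\bigl(\psi_+(z)\varphi_1(\tfrac z2)-\psi_-(z)\varphi_1(-\tfrac z2)\bigr)-\tfrac14\bigl(\chi_-(z)+\chi_+(z)\bigr),$$ $$\mathbf S=\tfrac12\begin{pmatrix}\tfrac\tau2\chi_-(\tau\mathbf B)&\tfrac\tau2\chi_+(\tau\mathbf B)\\ \phi_-(\tau\mathbf B)&\phi_+(\tau\mathbf B)\end{pmatrix}.$$ Conditions such as $\Phi_0=0$ mean that the function vanishes. $\|\cdot\|$ is the Euclidean/induced norm. $\mathcal O(\tau^j)$ means, for $\tau\to0$, a quantity bounded in norm by $C\tau^j$ with $C$ depending only on $T$, $K_q,K_v$, bounds on $E$ and its derivatives in a neighborhood of $K_q$, and the given data of the method ($L_E$, $C_{\mathbf S}$, $\vartheta$, $\vartheta_0$, and upper bounds for the norms of the filter matrices $\psi_\pm(\tau\mathbf B),\chi_\pm(\tau\mathbf B),\phi_\pm(\tau\mathbf B)$), but not on $\tau$, $n$ or $\|B\|$.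 *)

(* Defs.v *)
From HB Require Import structures.
From mathcomp Require Import all_boot all_order all_algebra.
From mathcomp Require Import spectral.
From mathcomp Require Import complex.
From mathcomp Require Import all_classical all_reals all_analysis.

Set Implicit Arguments.
Unset Strict Implicit.
Unset Printing Implicit Defensive.

Import Order.TTheory GRing.Theory Num.Theory.
Import numFieldNormedType.Exports.

Local Open Scope classical_set_scope.
Local Open Scope complex_scope.
Local Open Scope ring_scope.

Section EuclideanSpace.
Variable R : realType.

(* The library norm on matrices is the sup norm, hence the separate Euclidean
   norm below; topology, continuity and derivatives do not depend on the choice. *)
Definition enorm n (x : 'cV[R]_n) : R := Num.sqrt (\sum_i x i 0 ^+ 2).

Definition cenorm n (x : 'cV[R[i]]_n) : R :=
  Num.sqrt (\sum_i ComplexField.Normc.normc (x i 0) ^+ 2).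

Definition opnorm n (A : 'M[R[i]]_n) : R :=
  sup [set cenorm (A *m x) | x in [set x : 'cV[R[i]]_n | cenorm x <= 1]].

(* The indices i + 1 and i + 2 are taken modulo 3. *)
Definition crossv (u w : 'cV[R]_3) : 'cV[R]_3 :=
  \col_i (u (i + 1) 0 * w (i + 2) 0 - u (i + 2) 0 * w (i + 1) 0).

Definition Bmx (B : 'cV[R]_3) : 'M[R]_3 :=
  \matrix_(i, j) crossv (delta_mx j 0) B i 0.

Lemma Bmx_mul (B v : 'cV[R]_3) : Bmx B *m v = crossv v B.
Proof.
have sum_delta (a : 'I_3) : \sum_(j < 3) (a == j)%:R * v j 0 = v a 0.
  rewrite (bigD1 a) //= eqxx mul1r big1 ?addr0 // => j ja.
  by rewrite eq_sym (negPf ja) mul0r.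
apply/colP => i; rewrite !mxE -2!sum_delta !mulr_suml -sumrB.
apply: eq_bigr => j _; rewrite !mxE !andbT mulrBl.
by rewrite mulrAC [X in _ - X]mulrAC.
Qed.

Definition Ppar (B : 'cV[R]_3) : 'M[R]_3 := (enorm B ^+ 2)^-1 *: (B *m B^T).
Definition Pperp (B : 'cV[R]_3) : 'M[R]_3 := 1%:M - Ppar B.

End EuclideanSpace.

Section Smoothness.
Variables (R : realType) (V W : normedModType R).

(* f is of class C^k on the open set U.  In finite dimension, continuity of the
   derivative is continuity of all directional derivatives. *)
Fixpoint Ck (k : nat) (U : set V) (f : V -> W) : Prop :=
  if k is k'.+1 then
    (forall x, U x -> differentiable f x) /\
    (forall u, Ck k' U (fun x => 'D_u f x))
  else forall x, U x -> {for x, continuous f}.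

End Smoothness.

Section C2Bounds.
Variable R : realType.

Definition C2_bounded (M : R) (U : set 'cV[R]_3) (E : 'cV[R]_3 -> 'cV[R]_3) :=
  forall x, U x ->
    [/\ enorm (E x) <= M,
        (forall u, enorm ('D_u E x) <= M * enorm u) &
        (forall u w, enorm ('D_w (fun y => 'D_u E y) x) <=
                     M * enorm u * enorm w)].

Definition lipschitz_const (L : R) (E : 'cV[R]_3 -> 'cV[R]_3) :=
  forall x y, enorm (E x - E y) <= L * enorm (x - y).

(* At the end points of [0, T] the equations hold with one-sided derivatives as
   soon as q and v are continuous on [0, T] and solve them on ]0, T[. *)
Definition lorentz_solution (T : R) (E : 'cV[R]_3 -> 'cV[R]_3)
    (B q0 v0 : 'cV[R]_3) (q v : R -> 'cV[R]_3) :=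
  [/\ {within `[0, T], continuous q},
      {within `[0, T], continuous v},
      (forall t, 0 < t < T ->
         is_derive t 1 q (v t) /\
         is_derive t 1 v (crossv (v t) B + E (q t))),
      q 0 = q0 &
      v 0 = v0].

End C2Bounds.

Section ComplexFunctions.
Variable R : realType.
Local Notation C := R[i].
Implicit Types z : C.

Definition cexp z : C :=
  (expR (complex.Re z) * cos (complex.Im z)) +i* (expR (complex.Re z) * sin (complex.Im z)).

Definition csinh z : C := (cexp z - cexp (- z)) / 2.

Definition cint01 (f : R -> C) : C :=
  (\int[lebesgue_measure]_(s in `[0%R, 1%R]) complex.Re (f s)) +i*
  (\int[lebesgue_measure]_(s in `[0%R, 1%R]) complex.Im (f s)).

(* Meaningful for 1 <= k only. *)
Definition varphi (k : nat) z : C :=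
  cint01 (fun s => cexp ((1 - s)%:C * z) * (s ^+ k.-1 / (k.-1)`!%:R)%:C).

Definition sinch z : C := if z == 0 then 1 else csinh z / z.

(* (sinh z - z) / z^2 tends to 0 as z tends to 0. *)
Definition psi1sinh z : C := if z == 0 then 0 else (csinh z - z) / z ^+ 2.

End ComplexFunctions.

Section Integrator.
Variable R : realType.
Local Notation C := R[i].

Record filters := Filters {
  psim : C -> C; psip : C -> C;
  chim : C -> C; chip : C -> C;
  phim : C -> C; phip : C -> C }.

Implicit Types (f : filters) (z : C) (tau : R) (B : 'cV[R]_3).

Definition Phi0 f z : C := varphi 1 z - (phip f z + phim f z) / 2.

Definition Phi1 f z : C :=
  varphi 2 z - varphi 1 z / 2 - (phip f z - phim f z) / 4.

Definition Psi0 f z : C :=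
  sinch (z / 2) - (psim f z + psip f z * cexp z) * cexp (- (z / 2)) / 2.

Definition Psi1 f z : C :=
  psi1sinh (z / 2) / 2
  - (psip f z * varphi 1 (z / 2) - psim f z * varphi 1 (- (z / 2))) / 4
  - (chim f z + chip f z) / 4.

(* The eigenvalues of tau *: Bmx B; the filter functions only matter there. *)
Definition spectrum tau B : seq C :=
  [:: 0; 0 +i* (tau * enorm B); 0 -i* (tau * enorm B)].

Definition vanishes tau B (g : C -> C) :=
  forall z, z \in spectrum tau B -> g z = 0.

Definition toC m n (A : 'M[R]_(m, n)) : 'M[C]_(m, n) := map_mx (real_complex R) A.

(* Function of a normal matrix A = U^-1 D U, U unitary and D diagonal. *)
Definition mxfun n (g : C -> C) (A : 'M[C]_n) : 'M[C]_n :=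
  invmx (spectralmx A) *m diag_mx (map_mx g (spectral_diag A)) *m spectralmx A.

Definition funB (g : C -> C) tau B : 'M[C]_3 := mxfun g (toC (tau *: Bmx B)).

Definition Smx f tau B : 'M[C]_(3 + 3) :=
  2^-1 *: block_mx
    ((tau / 2)%:C *: funB (chim f) tau B) ((tau / 2)%:C *: funB (chip f) tau B)
    (funB (phim f) tau B)                 (funB (phip f) tau B).

Definition filters_bounded (M : R) f tau B :=
  [/\ opnorm (funB (psim f) tau B) <= M /\ opnorm (funB (psip f) tau B) <= M,
      opnorm (funB (chim f) tau B) <= M /\ opnorm (funB (chip f) tau B) <= M &
      opnorm (funB (phim f) tau B) <= M /\ opnorm (funB (phip f) tau B) <= M].

(* One step from (q0, v0) to (q1, v1).  The filter functions are complex valued,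
   so the equations between the real vectors are written in C^3. *)
Definition integrator_step f tau B (E : 'cV[R]_3 -> 'cV[R]_3)
    (q0 v0 q1 v1 : 'cV[R]_3) :=
  toC q1 = toC q0
    + (tau / 2)%:C *: (funB (psim f) tau B *m toC v0
                       + funB (psip f) tau B *m toC v1)
    + (tau ^+ 2 / 4)%:C *: (funB (chim f) tau B *m toC (E q0)
                            + funB (chip f) tau B *m toC (E q1))
  /\
  toC v1 = funB (@cexp R) tau B *m toC v0
    + (tau / 2)%:C *: (funB (phim f) tau B *m toC (E q0)
                       + funB (phip f) tau B *m toC (E q1)).

(* Only the steps that stay in [0, T] are constrained. *)
Definition integrator_solution f tau T B (E : 'cV[R]_3 -> 'cV[R]_3)
    (q0 v0 : 'cV[R]_3) (qn vn : nat -> 'cV[R]_3) :=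
  [/\ qn 0%N = q0, vn 0%N = v0 &
      forall n : nat, n.+1%:R * tau <= T ->
        integrator_step f tau B E (qn n) (vn n) (qn n.+1) (vn n.+1)].

End Integrator.

(* Main.v *)
Require Import Defs.
From mathcomp Require Import all_boot all_order all_algebra.
From mathcomp Require Import complex spectral.
From mathcomp Require Import all_classical all_reals all_analysis.
From mathcomp Require Import ring lra.
Import Order.TTheory GRing.Theory Num.Theory.
Import numFieldNormedType.Exports.
Set Implicit Arguments.
Unset Strict Implicit.
Unset Printing Implicit Defensive.
Local Open Scope classical_set_scope.
Local Open Scope complex_scope.
Local Open Scope ring_scope.
Import ComplexField.Normc.

(** The field is B = beta b with b a unit vector.  Complete b to an orthonormal
    frame b, p, r with r = p x b.  A motion q then splits into a real parallel
    part x = b.q, with velocity u and force F, and a complex perpendicular part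
    Q = (p + i r).q, with velocity y and force e, and the equations become
    x' = u, u' = F, Q' = y, y' = i beta y + e.  The matrix of v |-> v x B is
    normal with eigenvalues 0 and +- i beta, so the row vectors b and p + i r are
    left eigenvectors of every filter matrix, and the integrator splits in the
    same way into two scalar recursions in which each filter function is replaced
    by its value at 0 or at z = i tau beta.

    The order conditions turn these recursions into approximations of three exact
    laws.
    - Perpendicular velocity: y(t + tau) = e^z y(t) + (e^z - 1)/(i beta) e(t) up
      to O(tau^2).  Local errors of that size give a global error O(tau).
    - Guiding center: c = Q - y/(i beta) satisfies c' = -e/(i beta), which is
      O(tau) because 1/beta <= tau/vartheta0.  The numerical guiding center obeys
      the same law with weights of size O(tau^2), so its local error is O(tau^3)
      and its global error O(tau^2).  Since Q = c + y/(i beta), the O(tau) error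
      of y costs only O(tau^2) in Q.
    - Parallel velocity: the conditions at 0 reduce the recursion for u to the
      trapezoidal rule.  Its local error is only O(tau^2), because F oscillates
      with frequency beta, but the errors cancel in the sum (trapezoid_sum).
      Indeed F = G + K, where G has a slowly varying derivative and K, of size
      1/beta, is the oscillating part.  The trapezoidal rule has local error
      O(tau^3) for G.  The exact integral of K is O(1/beta^2), and the sum of the
      values of K is bounded by summation by parts: y is nearly multiplied by
      e^z at each step, and |e^z - 1| is bounded below by the nonresonance
      condition (oscillatory_sum, nonresonance).

    A discrete Gronwall argument (position_error) closes the recursions, the
    force errors being at most the Lipschitz constant times the position errors.
    The field E is differentiated only along the trajectory, whose points lie in
    Kq; so no constant depends on how far the neighborhood U of Kq extends. *)

(** * Mean value estimates on a closed interval *)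

Section Evolution.
Context {R : realType} (T : R).
Implicit Types f g df dg : R -> R.

(** A differential equation on [0, T] of the kind satisfied by a solution that is
    only known to be differentiable in the interior. *)
Definition evolves f df :=
  {within `[0, T], continuous f} /\
  forall t, 0 < t < T -> is_derive t 1 f (df t).

Lemma evolves_ext f df dg :
  evolves f df -> (forall t, df t = dg t) -> evolves f dg.
Proof. by move=> [cf Hf] e; split=> // t /Hf; rewrite e. Qed.

Lemma evolvesD f g df dg : evolves f df -> evolves g dg ->
  evolves (fun t => f t + g t) (fun t => df t + dg t).
Proof.
move=> [cf Hf] [cg Hg]; split; first exact: (within_continuousD cf cg).
by move=> t tT; have := is_deriveD (Hf t tT) (Hg t tT).
Qed.

Lemma evolvesM f g df dg : evolves f df -> evolves g dg ->
  evolves (fun t => f t * g t) (fun t => df t * g t + f t * dg t).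
Proof.
move=> [cf Hf] [cg Hg]; split; first by move=> t; apply: cvgM; [exact: cf|exact: cg].
move=> t tT; have := is_deriveM (Hf t tT) (Hg t tT).
by rewrite addrC; congr (is_derive _ _ _ (_ + _)); rewrite /GRing.scale /= mulrC.
Qed.

Lemma evolves_derivable f df : (forall t : R, is_derive t 1 f (df t)) -> evolves f df.
Proof.
move=> Hf; split=> [|t _]; last exact: Hf.
by apply: derivable_within_continuous => t _; exact: ex_derive.
Qed.

Lemma evolves_cst c : evolves (fun=> c) (fun=> 0).
Proof. by apply: evolves_derivable => t; exact: is_derive_cst. Qed.

Lemma evolves_id : evolves (fun t => t) (fun=> 1).
Proof. by apply: evolves_derivable => t; exact: is_derive_id. Qed.

Lemma evolvesZ c f df : evolves f df ->
  evolves (fun t => c * f t) (fun t => c * df t).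
Proof.
move=> /(evolvesM (evolves_cst c)) /evolves_ext; apply=> t.
by rewrite mul0r add0r.
Qed.

Lemma evolvesB f g df dg : evolves f df -> evolves g dg ->
  evolves (fun t => f t - g t) (fun t => df t - dg t).
Proof.
move=> Hf /(evolvesZ (-1)) /(evolvesD Hf).
rewrite (_ : (fun t => f t + -1 * g t) = (fun t => f t - g t)); last first.
  by apply/funext => t; rewrite mulN1r.
by move=> /evolves_ext; apply=> t; rewrite mulN1r.
Qed.

Lemma evolves_cos c a :
  evolves (fun t => cos (c * (t - a))) (fun t => - (c * sin (c * (t - a)))).
Proof.
apply: evolves_derivable => t.
have H := is_deriveM (is_derive_cst c t 1)
  (is_deriveB (is_derive_id t 1) (is_derive_cst a t 1)).
have H2 := @is_derive1_comp R cos _ t _ _ (is_derive_cos _) H.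
by apply: (is_derive_eq H2); rewrite /GRing.scale /=; ring.
Qed.

Lemma evolves_sin c a :
  evolves (fun t => sin (c * (t - a))) (fun t => c * cos (c * (t - a))).
Proof.
apply: evolves_derivable => t.
have H := is_deriveM (is_derive_cst c t 1)
  (is_deriveB (is_derive_id t 1) (is_derive_cst a t 1)).
have H2 := @is_derive1_comp R sin _ t _ _ (is_derive_sin _) H.
by apply: (is_derive_eq H2); rewrite /GRing.scale /=; ring.
Qed.

(** Mean value theorem for f - c t. *)
Lemma increment_near f df c K a b : evolves f df -> 0 <= a -> a <= b -> b <= T ->
  (forall t, a < t < b -> `|df t - c| <= K) ->
  `|f b - f a - c * (b - a)| <= K * (b - a).
Proof.
move=> Hf a0 ab bT HK.
have [<-|neq] := eqVneq a b; first by rewrite !subrr !mulr0 subr0 normr0.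
have {}ab : a < b by rewrite lt_neqAle neq.
have [ch Hh] := evolvesB Hf (evolvesZ c evolves_id).
have [t|t|t tab E] := @MVT R (fun t => f t - c * t) (fun t => df t - c * 1) a b ab.
- rewrite in_itv /= => /andP[ta tb]; apply: Hh.
  by rewrite (le_lt_trans a0 ta) (lt_le_trans tb bT).
- apply: continuous_subspaceW t; last exact: ch.
  by apply: subset_itv; rewrite bnd_simp.
rewrite (_ : _ - _ = (f b - c * b) - (f a - c * a)); last by ring.
rewrite E mulr1 normrM (gtr0_norm (_ : 0 < b - a)) ?subr_gt0 //.
by rewrite ler_wpM2r ?subr_ge0 ?(ltW ab) // HK // -in_itv.
Qed.

Lemma increment_bound f df K a b : evolves f df -> 0 <= a -> a <= b -> b <= T ->
  (forall t, a < t < b -> `|df t| <= K) -> `|f b - f a| <= K * (b - a).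
Proof.
move=> Hf a0 ab bT HK; have := @increment_near f df 0 K a b Hf a0 ab bT.
by rewrite mul0r subr0; apply=> t /HK; rewrite subr0.
Qed.

(** Two-level form of Taylor's formula: f' is compared with g and g' with the
    constant c, so that f need not be twice differentiable. *)
Lemma taylor2_near f df g dg c e1 e2 a b : evolves f df -> evolves g dg ->
  0 <= a -> a <= b -> b <= T -> 0 <= e2 ->
  (forall t, a < t < b -> `|df t - g t| <= e1) ->
  (forall t, a < t < b -> `|dg t - c| <= e2) ->
  `|f b - f a - (g a * (b - a) + c * (b - a) ^+ 2 / 2)|
    <= e1 * (b - a) + e2 * (b - a) ^+ 2.
Proof.
move=> Hf Hg a0 ab bT e20 Hdf Hdg.
have Hsq : evolves (fun t => (t - a) * (t - a)) (fun t => 2 * (t - a)).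
  have H := evolvesB evolves_id (evolves_cst a).
  by have := evolvesM H H; move/evolves_ext; apply => t; ring.
have /increment_near := evolvesB Hf (evolvesZ (c / 2) Hsq).
move=> /(_ (g a) (e1 + e2 * (b - a)) a b a0 ab bT) /= H.
rewrite (_ : _ - _ = f b - c / 2 * ((b - a) * (b - a)) -
   (f a - c / 2 * ((a - a) * (a - a))) - g a * (b - a)); last by field.
apply: le_trans (H _) _; last by rewrite mulrDl expr2 mulrA lexx.
move=> t /andP[ta tb].
rewrite (_ : _ - g a = (df t - g t) + (g t - g a - c * (t - a))); last by field.
apply: le_trans (ler_normD _ _) (lerD (Hdf _ _) _); first by rewrite ta tb.
have := @increment_near g dg c e2 a t Hg a0 (ltW ta) (le_trans (ltW tb) bT).
move=> H1; apply: le_trans (H1 _) _ => [s /andP[sa st]|].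
  by apply: Hdg; rewrite sa (lt_trans st tb).
by rewrite ler_wpM2l // lerD2r ltW.
Qed.

(** The trapezoidal rule replaces the slope c of taylor2_near by the actual
    increment of g, at the price of another mean value error for g. *)
Lemma trapezoid_near f df g dg c e1 e2 a b : evolves f df -> evolves g dg ->
  0 <= a -> a <= b -> b <= T -> 0 <= e2 ->
  (forall t, a < t < b -> `|df t - g t| <= e1) ->
  (forall t, a < t < b -> `|dg t - c| <= e2) ->
  `|f b - f a - (b - a) / 2 * (g a + g b)|
    <= e1 * (b - a) + 2 * e2 * (b - a) ^+ 2.
Proof.
move=> Hf Hg a0 ab bT e20 Hdf Hdg.
have H1 := taylor2_near Hf Hg a0 ab bT e20 Hdf Hdg.
have H2 := increment_near Hg a0 ab bT Hdg.
rewrite (_ : _ - _ = (f b - f a - (g a * (b - a) + c * (b - a) ^+ 2 / 2)) -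
   (b - a) / 2 * (g b - g a - c * (b - a))); last by field.
apply: le_trans (ler_normB _ _) _.
have ba : 0 <= b - a by rewrite subr_ge0.
rewrite normrM (ger0_norm (_ : 0 <= (b - a) / 2)) ?divr_ge0 //.
apply: le_trans (lerD H1 (ler_wpM2l _ H2)) _; first by rewrite divr_ge0.
have := mulr_ge0 e20 (sqr_ge0 (b - a)).
by nra.
Qed.

End Evolution.

(** * Fast rotations in the complex plane *)

Section Modulus.
Context {R : realType}.
Local Notation C := R[i].
Implicit Types (z w : C) (a b : R).

Lemma complex_eq z w :
  complex.Re z = complex.Re w -> complex.Im z = complex.Im w -> z = w.
Proof. by case: z w => [a b] [c d] /= -> ->. Qed.

Lemma normcD z w : normc (z + w) <= normc z + normc w.
Proof. exact: (@le_normcD R z w). Qed.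

Lemma normc_opp z : normc (- z) = normc z.
Proof. exact: (@normcN R z). Qed.

Lemma normcB z w : normc (z - w) <= normc z + normc w.
Proof. by rewrite -[normc w]normc_opp normcD. Qed.

Lemma normc_ge0 z : 0 <= normc z.
Proof. by case: z => a b; rewrite sqrtr_ge0. Qed.

Lemma normc_real a : normc a%:C = `|a|.
Proof. by rewrite /= expr0n addr0 sqrtr_sqr. Qed.

Lemma normc_imag a : normc (0 +i* a) = `|a|.
Proof. by rewrite /= expr0n add0r sqrtr_sqr. Qed.

Lemma normc_le z : normc z <= `|complex.Re z| + `|complex.Im z|.
Proof.
case: z => a b /=; rewrite -[leRHS]ger0_norm ?addr_ge0 // -sqrtr_sqr.
rewrite ler_wsqrtr // sqrrD !real_normK ?num_real // lerD2r lerDl.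
by rewrite mulrn_wge0 // mulr_ge0.
Qed.

Lemma Re_le_normc z : `|complex.Re z| <= normc z.
Proof. by case: z => a b /=; rewrite -sqrtr_sqr ler_wsqrtr // lerDl sqr_ge0. Qed.

Lemma Im_le_normc z : `|complex.Im z| <= normc z.
Proof. by case: z => a b /=; rewrite -sqrtr_sqr ler_wsqrtr // lerDr sqr_ge0. Qed.

Lemma normc_sum n (f : 'I_n -> C) (c : R) : (forall i, normc (f i) <= c) ->
  normc (\sum_i f i) <= n%:R * c.
Proof.
move=> Hf; rewrite (_ : n%:R * c = \sum_(i < n) c); last first.
  by rewrite sumr_const card_ord mulr_natl.
elim/big_ind2 : _ => [|z a w b Hz Hw|i _]; first by rewrite normc0.
  exact: le_trans (normcD _ _) (lerD Hz Hw).
exact: Hf.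
Qed.

Lemma cexp_imag a : cexp (0 +i* a) = cos a +i* sin a :> C.
Proof. by rewrite /cexp /= expR0 !mul1r. Qed.

Lemma normc_cexp_imag a : normc (cexp (0 +i* a)) = 1.
Proof. by rewrite cexp_imag /= cos2Dsin2 sqrtr1. Qed.

Lemma imag_neq0 a : a != 0 -> 0 +i* a != 0 :> C.
Proof. by move=> a0; rewrite eq_complex /= negb_and a0 orbT. Qed.

Lemma divc_imag z b : b != 0 ->
  z / (0 +i* b) = (complex.Im z / b) +i* (- (complex.Re z / b)).
Proof.
move=> b0; apply: (mulIf (imag_neq0 b0)); rewrite divfK ?imag_neq0 //.
by case: z => x y /=; apply: complex_eq => /=; field.
Qed.

(** Summation by parts.  As om y_j is close to y_(j+1), the sum of
    (om - 1) al_j y_j is nearly that of al_j (y_(j+1) - y_j), which telescopes up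
    to the small increments of al. *)
Lemma oscillatory_sum (al y : nat -> C) (om : C) (A Y a r : R) n :
  (forall j, (j <= n)%N -> normc (al j) <= A) ->
  (forall j, (j < n)%N -> normc (al j.+1 - al j) <= a) ->
  (forall j, (j <= n)%N -> normc (y j) <= Y) ->
  (forall j, (j < n)%N -> normc (y j.+1 - om * y j) <= r) ->
  normc ((om - 1) * \sum_(j < n) al j * y j) <= 2 * A * Y + n%:R * (a * Y + A * r).
Proof.
move=> HA Ha HY Hr.
have -> : (om - 1) * \sum_(j < n) al j * y j = al n * y n - al 0%N * y 0%N
   - \sum_(j < n) ((al j.+1 - al j) * y j.+1 + al j * (y j.+1 - om * y j)).
  elim: n {HA Ha HY Hr} => [|n IH]; first by rewrite !big_ord0; ring.
  by rewrite !big_ord_recr /= mulrDr IH; ring.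
apply: le_trans (normcB _ _) (lerD _ _).
  apply: le_trans (normcB _ _) _; rewrite !normcM -mulrA mulr_natl mulr2n.
  by apply: lerD; apply: ler_pM; rewrite ?normc_ge0 // ?HA ?HY.
apply: normc_sum => j; apply: le_trans (normcD _ _) _; rewrite !normcM.
by apply: lerD; apply: ler_pM; rewrite ?normc_ge0 // ?HA ?HY ?Ha ?Hr // ltnW.
Qed.

(** Variation of constants for y' = i be y + e with e close to the constant
    c1 + i c2: in the rotating frame the difference between y and the solution for
    the constant force has the derivative e - (c1 + i c2), rotated. *)
Lemma rotation_near (T be c1 c2 ep a b : R) (y1 y2 e1 e2 : R -> R)
    (om := cexp (0 +i* (be * (b - a)))) :
  be != 0 ->
  evolves T y1 (fun t => - (be * y2 t) + e1 t) ->
  evolves T y2 (fun t => be * y1 t + e2 t) ->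
  0 <= a -> a <= b -> b <= T ->
  (forall t, a < t < b -> `|e1 t - c1| <= ep) ->
  (forall t, a < t < b -> `|e2 t - c2| <= ep) ->
  normc ((y1 b +i* y2 b) - om * (y1 a +i* y2 a) - (om - 1) / (0 +i* be) * (c1 +i* c2))
    <= 4 * ep * (b - a).
Proof.
move=> be0 H1 H2 a0 ab bT He1 He2.
have HC := evolves_cos T be a; have HS := evolves_sin T be a.
(* Up to an additive constant, Z1 + i Z2 is e^(-i be (t - a)) y minus the response
   to the constant force. *)
pose Z1 t := cos (be * (t - a)) * y1 t + sin (be * (t - a)) * y2 t
  - (c1 / be * sin (be * (t - a)) - c2 / be * cos (be * (t - a))).
pose Z2 t := cos (be * (t - a)) * y2 t - sin (be * (t - a)) * y1 t
  - (c2 / be * sin (be * (t - a)) + c1 / be * cos (be * (t - a))).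
have HZ1 : evolves T Z1 (fun t => cos (be * (t - a)) * (e1 t - c1)
    + sin (be * (t - a)) * (e2 t - c2)).
  have := evolvesB (evolvesD (evolvesM HC H1) (evolvesM HS H2))
    (evolvesB (evolvesZ (c1 / be) HS) (evolvesZ (c2 / be) HC)).
  by move/evolves_ext; apply => t; field.
have HZ2 : evolves T Z2 (fun t => cos (be * (t - a)) * (e2 t - c2)
    - sin (be * (t - a)) * (e1 t - c1)).
  have := evolvesB (evolvesB (evolvesM HC H2) (evolvesM HS H1))
    (evolvesD (evolvesZ (c2 / be) HS) (evolvesZ (c1 / be) HC)).
  by move/evolves_ext; apply => t; field.
have small t x y : `|x| <= ep -> `|y| <= ep ->
    `|cos t * x + sin t * y| <= 2 * ep.
  move=> Hx Hy; apply: le_trans (ler_normD _ _) _; rewrite mulr_natl mulr2n !normrM.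
  have C1 : `|cos t| <= 1 by rewrite ler_norml cos_geN1 cos_le1.
  have S1 : `|sin t| <= 1 by rewrite ler_norml sin_geN1 sin_le1.
  by apply: lerD; rewrite -[leRHS]mul1r ler_pM.
have D1 : `|Z1 b - Z1 a| <= 2 * ep * (b - a).
  apply: (increment_bound HZ1) => // t tab; apply: small; first exact: He1.
  exact: He2.
have D2 : `|Z2 b - Z2 a| <= 2 * ep * (b - a).
  apply: (increment_bound HZ2) => // t tab; rewrite -mulrN; apply: small; first exact: He2.
  by rewrite normrN; apply: He1.
rewrite (_ : _ - _ = om * ((Z1 b - Z1 a) +i* (Z2 b - Z2 a))); last first.
  rewrite divc_imag // /om cexp_imag /Z1 /Z2 subrr mulr0 cos0 sin0.
  move: (cos2Dsin2 (be * (b - a))); set c := cos _; set s := sin _ => cs.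
  have {}cs : s ^+ 2 = 1 - c ^+ 2 by rewrite -cs; ring.
  by apply: complex_eq => /=; field: cs.
rewrite normcM normc_cexp_imag mul1r; apply: le_trans (normc_le _) _ => /=.
apply: le_trans (lerD D1 D2) _; lra.
Qed.

Definition tame (T M : R) (f : R -> R) := exists df,
  [/\ evolves T f df, forall t, 0 <= t <= T -> `|f t| <= M
    & forall t, 0 < t < T -> `|df t| <= M].

Lemma tame_bound T M f t : tame T M f -> 0 <= t <= T -> `|f t| <= M.
Proof. by case=> df [_ + _]; apply. Qed.

Lemma tame_increment T M f a b : tame T M f -> 0 <= a -> a <= b -> b <= T ->
  `|f b - f a| <= M * (b - a).
Proof.
case=> df [Hf _ Hdf] a0 ab bT; apply: (increment_bound Hf) => // t /andP[ta tb].
by apply: Hdf; rewrite (le_lt_trans a0 ta) (lt_le_trans tb bT).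
Qed.

End Modulus.

(** * Consistency of the exact motion with the recursions *)

(** Scalar form of a trajectory in the frame b, p, r.  The functions grad_b,
    grad_p, grad_r are the derivatives of the parallel force in the directions of
    the frame; they are the only trace of the spatial dependence of the field. *)
Record gyromotion (R : realType) (T M be : R) := Gyromotion {
  par_pos : R -> R; par_vel : R -> R; par_force : R -> R;
  perp_pos1 : R -> R; perp_pos2 : R -> R; perp_vel1 : R -> R; perp_vel2 : R -> R;
  perp_force1 : R -> R; perp_force2 : R -> R;
  grad_b : R -> R; grad_p : R -> R; grad_r : R -> R;
  evolves_par_pos : evolves T par_pos par_vel;
  evolves_par_vel : evolves T par_vel par_force;
  evolves_par_force : evolves T par_force (fun t =>
    grad_b t * par_vel t + grad_p t * perp_vel1 t + grad_r t * perp_vel2 t);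
  evolves_perp_pos1 : evolves T perp_pos1 perp_vel1;
  evolves_perp_pos2 : evolves T perp_pos2 perp_vel2;
  evolves_perp_vel1 : evolves T perp_vel1 (fun t => - (be * perp_vel2 t) + perp_force1 t);
  evolves_perp_vel2 : evolves T perp_vel2 (fun t => be * perp_vel1 t + perp_force2 t);
  par_vel_bound : forall t, 0 <= t <= T -> `|par_vel t| <= M;
  par_force_bound : forall t, 0 <= t <= T -> `|par_force t| <= M;
  perp_vel1_bound : forall t, 0 <= t <= T -> `|perp_vel1 t| <= M;
  perp_vel2_bound : forall t, 0 <= t <= T -> `|perp_vel2 t| <= M;
  perp_force1_tame : tame T M perp_force1; perp_force2_tame : tame T M perp_force2;
  grad_b_tame : tame T M grad_b; grad_p_tame : tame T M grad_p; grad_r_tame : tame T M grad_r }.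

(** Bookkeeping for the splitting u = v + w, F = G + K into slow and fast parts:
    v is compared with the trapezoidal sum of G, and the rest is boundary terms
    and the plain sum of K. *)
Lemma trapezoid_split (R : realType) (tau : R) (u v w F G K : nat -> R) n :
  (forall j, u j = v j + w j) -> (forall j, F j = G j + K j) ->
  u n - u 0%N - tau / 2 * \sum_(j < n) (F j + F j.+1) =
  \sum_(j < n) (v j.+1 - v j - tau / 2 * (G j + G j.+1)) + (w n - w 0%N)
  - (tau * \sum_(j < n) K j + tau / 2 * (K n - K 0%N)).
Proof.
move=> Hu HF; elim: n => [|n IH]; first by rewrite !big_ord0; field.
rewrite !big_ord_recr /=.
rewrite (_ : _ - _ = (u n - u 0%N - tau / 2 * \sum_(j < n) (F j + F j.+1))
  + (u n.+1 - u n) - tau / 2 * (F n + F n.+1)); last by ring.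
by rewrite IH !Hu !HF; field.
Qed.

Section Consistency.
Context {R : realType} (T M be tau : R).
Hypotheses (M_ge1 : 1 <= M) (TM : T <= M) (be_gt0 : 0 < be) (tau_gt0 : 0 < tau)
  (be_inv : be^-1 <= M * tau).
Variable g : gyromotion T M be.
Local Notation om := (cexp (0 +i* (be * tau))).

Definition perp_pos t := perp_pos1 g t +i* perp_pos2 g t.
Definition perp_vel t := perp_vel1 g t +i* perp_vel2 g t.
Definition perp_force t := perp_force1 g t +i* perp_force2 g t.

Let be_neq0 : be != 0. Proof. by rewrite gt_eqF. Qed.
Let M_ge0 : 0 <= M. Proof. exact: le_trans M_ge1. Qed.
Let bi_ge0 : 0 <= be^-1. Proof. by rewrite invr_ge0 ltW. Qed.

Lemma par_force_increment a b : 0 <= a -> a <= b -> b <= T ->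
  `|par_force g b - par_force g a| <= 3 * M ^+ 2 * (b - a).
Proof.
move=> a0 ab bT; apply: (increment_bound (evolves_par_force g)) => // t /andP[ta tb].
have tT : 0 <= t <= T by rewrite (le_trans a0 (ltW ta)) (le_trans (ltW tb) bT).
have := tame_bound (grad_b_tame g) tT; have := tame_bound (grad_p_tame g) tT.
have := tame_bound (grad_r_tame g) tT.
move=> Hr Hp Hb.
rewrite (_ : 3 * M ^+ 2 = M * M + M * M + M * M); last by ring.
apply: le_trans (ler_normD _ _) (lerD _ _).
  by apply: le_trans (ler_normD _ _) (lerD _ _); rewrite normrM ler_pM
    ?par_vel_bound ?perp_vel1_bound.
by rewrite normrM ler_pM ?perp_vel2_bound.
Qed.

Lemma perp_force_increment a b : 0 <= a -> a <= b -> b <= T ->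
  normc (perp_force b - perp_force a) <= 2 * M * (b - a).
Proof.
move=> a0 ab bT; apply: le_trans (normc_le _) _ => /=.
have := tame_increment (perp_force1_tame g) a0 ab bT.
have := tame_increment (perp_force2_tame g) a0 ab bT.
by lra.
Qed.

Lemma perp_vel_bound t : 0 <= t <= T -> normc (perp_vel t) <= 2 * M.
Proof.
move=> tT; apply: le_trans (normc_le _) _ => /=.
have := perp_vel1_bound g tT; have := perp_vel2_bound g tT; lra.
Qed.

Section OneStep.
Variable t : R.
Hypotheses (t_ge0 : 0 <= t) (tT : t + tau <= T).

Let sub_tau : t + tau - t = tau. Proof. by rewrite addrC addKr. Qed.
Let le_tau : t <= t + tau. Proof. by rewrite lerDl ltW. Qed.
Let inT s : t < s < t + tau -> 0 <= s <= T.
Proof. by move=> /andP[a b]; rewrite (le_trans t_ge0 (ltW a)) (le_trans (ltW b) tT). Qed.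

Let near f s : tame T M f -> t < s < t + tau -> `|f s - f t| <= M * tau.
Proof.
move=> Hf /andP[ts st].
apply: le_trans (tame_increment Hf t_ge0 (ltW ts) (le_trans (ltW st) tT)) _.
by rewrite ler_wpM2l // lerBlDl ltW.
Qed.

(** A Taylor expansion suffices, since F changes by O(tau) within a step. *)
Lemma parallel_step :
  `|par_pos g (t + tau) - par_pos g t - (par_vel g t * tau + par_force g t * tau ^+ 2 / 2)|
    <= 3 * M ^+ 2 * tau ^+ 3.
Proof.
have := @taylor2_near _ _ _ _ _ _ (par_force g t) 0 (3 * M ^+ 2 * tau) t (t + tau)
  (evolves_par_pos g) (evolves_par_vel g).
rewrite sub_tau mul0r add0r.
rewrite (_ : 3 * M ^+ 2 * tau * _ = 3 * M ^+ 2 * tau ^+ 3); last by ring.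
apply=> //.
- by rewrite !mulr_ge0 ?sqr_ge0 // ltW.
- by move=> s _; rewrite subrr normr0.
- move=> s /andP[ts st].
  apply: le_trans (par_force_increment t_ge0 (ltW ts) (le_trans (ltW st) tT)) _.
  by rewrite ler_wpM2l ?mulr_ge0 // lerBlDl ltW.
Qed.

Lemma velocity_step :
  normc (perp_vel (t + tau) - om * perp_vel t - (om - 1) / (0 +i* be) * perp_force t)
    <= 4 * M * tau ^+ 2.
Proof.
have := rotation_near be_neq0 (evolves_perp_vel1 g) (evolves_perp_vel2 g) t_ge0 le_tau tT
  (fun s => near (perp_force1_tame g)) (fun s => near (perp_force2_tame g)).
by rewrite sub_tau => H; apply: le_trans H _; rewrite expr2; lra.
Qed.

(** Here the whole force is treated as a perturbation of the rotation. *)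
Lemma velocity_step_crude :
  normc (perp_vel (t + tau) - om * perp_vel t) <= 4 * M * tau.
Proof.
have := @rotation_near _ T be 0 0 M t (t + tau) _ _ _ _ be_neq0
   (evolves_perp_vel1 g) (evolves_perp_vel2 g) t_ge0 le_tau tT.
rewrite sub_tau (_ : 0 +i* 0 = 0) // mulr0 subr0; apply => s /inT.
  by rewrite subr0; apply: tame_bound (perp_force1_tame g).
by rewrite subr0; apply: tame_bound (perp_force2_tame g).
Qed.

(** The center of the gyration: subtracting y/(i beta) removes the oscillation
    from the position. *)
Definition guiding_center s := perp_pos s - perp_vel s / (0 +i* be).

(** The oscillating velocity drops out of the derivative -e/(i beta) of the
    guiding center; the factor 1/beta supplies the third power of tau. *)
Lemma center_step :
  normc (guiding_center (t + tau) - guiding_center t + tau%:C * perp_force t / (0 +i* be))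
    <= 2 * M ^+ 2 * tau ^+ 3.
Proof.
have H1 : evolves T (fun s => perp_pos1 g s - be^-1 * perp_vel2 g s)
    (fun s => - (be^-1 * perp_force2 g s)).
  have := evolvesB (evolves_perp_pos1 g) (evolvesZ be^-1 (evolves_perp_vel2 g)).
  by move/evolves_ext; apply=> s; field.
have H2 : evolves T (fun s => perp_pos2 g s + be^-1 * perp_vel1 g s)
    (fun s => be^-1 * perp_force1 g s).
  have := evolvesD (evolves_perp_pos2 g) (evolvesZ be^-1 (evolves_perp_vel1 g)).
  by move/evolves_ext; apply=> s; field.
have bound f s : tame T M f -> t < s < t + tau ->
    `|be^-1 * f s - be^-1 * f t| <= (M * tau) * (M * tau).
  by move=> Hf ts; rewrite -mulrBr normrM ler_pM // ?near // ger0_norm.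
have := increment_near H1 t_ge0 le_tau tT
  (c := - (be^-1 * perp_force2 g t)) (K := (M * tau) * (M * tau)).
move=> /(_ _)/wrap[s ts|D1].
  by rewrite -opprB opprK normrN addrC; apply: bound (perp_force2_tame g) _.
have := increment_near H2 t_ge0 le_tau tT
  (c := be^-1 * perp_force1 g t) (K := (M * tau) * (M * tau)).
move=> /(_ _)/wrap[s ts|D2]; first by apply: bound (perp_force1_tame g) _.
rewrite sub_tau in D1 D2.
apply: le_trans (normc_le _) _; rewrite /guiding_center !divc_imag //= .
rewrite (_ : 2 * M ^+ 2 * tau ^+ 3 =
  M * tau * (M * tau) * tau + M * tau * (M * tau) * tau); last by ring.
apply: lerD; [apply: le_trans D1|apply: le_trans D2];
  rewrite le_eqVlt; apply/orP; left; apply/eqP; congr (`| _ |); by field.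
Qed.

End OneStep.

(* K is the part of the parallel force that oscillates at first order in 1/be,
   and W is an antiderivative of K up to O(be^-2): as y' is nearly i be y, one
   integrates y by dividing it by i be. *)
Local Notation K := (fun t =>
  be^-1 * (grad_p g t * perp_vel2 g t - grad_r g t * perp_vel1 g t)).
Local Notation G := (fun t => par_force g t - K t).
Local Notation W := (fun t =>
  - (be ^- 2) * (grad_p g t * perp_vel1 g t + grad_r g t * perp_vel2 g t)).
Local Notation V := (fun t => par_vel g t - W t).

(** V' differs from G by O(be^-2), and G' from the slowly varying grad_b u by
    O(be^-1), because every term containing be cancels. *)
Lemma slow_trapezoid t : 0 <= t -> t + tau <= T ->
  `|V (t + tau) - V t - tau / 2 * (G t + G (t + tau))|
    <= (4 * M ^+ 2 + 12 * M ^+ 4) * tau ^+ 3.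
Proof.
move=> t0 tT.
have [dp [Hp Bp Bdp]] := grad_p_tame g; have [dr [Hr Br Bdr]] := grad_r_tame g.
have le_tau : t <= t + tau by rewrite lerDl ltW.
have inT s : t < s < t + tau -> 0 < s < T.
  by move=> /andP[a b]; rewrite (le_lt_trans t0 a) (lt_le_trans b tT).
(* Both remainders are be^-1 or be^-2 times four products of bounded factors. *)
have four (a b c d e f h k : R) : `|a| <= M -> `|b| <= M -> `|c| <= M -> `|d| <= M ->
   `|e| <= M -> `|f| <= M -> `|h| <= M -> `|k| <= M ->
   `|a * b - c * d + e * f - h * k| <= 4 * M ^+ 2.
  move=> *; rewrite (_ : 4 * M ^+ 2 = M * M + M * M + M * M + M * M); last by ring.
  by apply: le_trans (ler_normB _ _) (lerD (le_trans (ler_normD _ _)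
    (lerD (le_trans (ler_normB _ _) (lerD _ _)) _)) _); rewrite normrM ler_pM.
have HG : evolves T G (fun s => grad_b g s * par_vel g s -
    be^-1 * (dp s * perp_vel2 g s - dr s * perp_vel1 g s
      + grad_p g s * perp_force2 g s - grad_r g s * perp_force1 g s)).
  have := evolvesB (evolves_par_force g) (evolvesZ be^-1 (evolvesB
    (evolvesM Hp (evolves_perp_vel2 g)) (evolvesM Hr (evolves_perp_vel1 g)))).
  by move/evolves_ext; apply=> s; field.
have HV : evolves T V (fun s => G s +
    be^-2 * (dp s * perp_vel1 g s - - dr s * perp_vel2 g s
      + grad_p g s * perp_force1 g s - - grad_r g s * perp_force2 g s)).
  have := evolvesB (evolves_par_vel g) (evolvesZ (- be ^- 2) (evolvesD
    (evolvesM Hp (evolves_perp_vel1 g)) (evolvesM Hr (evolves_perp_vel2 g)))).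
  by move/evolves_ext; apply=> s; field.
have taule : 0 <= M * tau by rewrite mulr_ge0 // ltW.
have := @trapezoid_near _ _ _ _ _ _ (grad_b g t * par_vel g t) (4 * M ^+ 4 * tau ^+ 2)
  ((2 * M ^+ 2 + 4 * M ^+ 3) * tau) t (t + tau) HV HG t0 le_tau tT.
rewrite (_ : t + tau - t = tau); last by rewrite addrC addKr.
move=> H; apply: le_trans (H _ _ _) _.
- by rewrite mulr_ge0 ?ltW // addr_gt0 ?mulr_gt0 ?exprn_gt0 ?(lt_le_trans ltr01 M_ge1).
- move=> s /inT sT; have /andP[/ltW s0 /ltW sT'] := sT.
  have sTe : 0 <= s <= T by rewrite s0.
  rewrite /= [X in `|X|]addrAC subrr add0r normrM.
  rewrite (_ : 4 * M ^+ 4 * tau ^+ 2 = (M * tau) ^+ 2 * (4 * M ^+ 2)); last by ring.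
  apply: ler_pM => //; last first.
    by apply: four; rewrite ?normrN ?Bdp ?Bdr ?Bp ?Br ?perp_vel1_bound ?perp_vel2_bound
      ?(tame_bound (perp_force1_tame g)) ?(tame_bound (perp_force2_tame g)).
  by rewrite -exprVn ger0_norm ?exprn_ge0 // ler_pXn2r.
- move=> s ts; have sT := inT _ ts; have /andP[/ltW s0 /ltW sT'] := sT.
  have sTe : 0 <= s <= T by rewrite s0.
  have tTe : 0 <= t <= T by rewrite t0 (le_trans le_tau).
  have /andP[tsl tsr] := ts.
  rewrite (_ : _ - _ = (grad_b g s - grad_b g t) * par_vel g s
    + grad_b g t * (par_vel g s - par_vel g t)
    - be^-1 * (dp s * perp_vel2 g s - dr s * perp_vel1 g s
      + grad_p g s * perp_force2 g s - grad_r g s * perp_force1 g s)); last by ring.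
  rewrite (_ : _ * tau = (M * tau) * M + M * (M * tau) + (M * tau) * (4 * M ^+ 2)); last by ring.
  have st : s - t <= tau by rewrite lerBlDl ltW.
  apply: le_trans (ler_normB _ _) (lerD (le_trans (ler_normD _ _) (lerD _ _)) _); rewrite normrM.
  + rewrite ler_pM ?par_vel_bound //.
    by apply: le_trans (tame_increment (grad_b_tame g) t0 (ltW tsl) sT') _; rewrite ler_wpM2l.
  + rewrite ler_pM ?(tame_bound (grad_b_tame g)) //.
    apply: le_trans (_ : M * (s - t) <= _); last by rewrite ler_wpM2l.
    apply: (increment_bound (evolves_par_vel g)) => // [|v /andP[tv vs]]; first exact: ltW.
    by apply: par_force_bound; rewrite (le_trans t0 (ltW tv)) (le_trans (ltW vs)).
  + rewrite ler_pM ?normr_ge0 //; first by rewrite ger0_norm.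
    by apply: four; rewrite ?Bdp ?Bdr ?Bp ?Br ?perp_vel1_bound ?perp_vel2_bound
      ?(tame_bound (perp_force1_tame g)) ?(tame_bound (perp_force2_tame g)).
- rewrite [leLHS](_ : _ = (4 * M ^+ 4 + 4 * M ^+ 2 + 8 * M ^+ 3) * tau ^+ 3); last by ring.
  apply: ler_wpM2r; first by rewrite exprn_ge0 // ltW.
  have : M ^+ 3 <= M ^+ 4 by rewrite ler_weXn2l.
  by lra.
Qed.

(** K is be^-1 times the imaginary part of (grad_p - i grad_r) y, the product of a
    slow factor and a rotating one. *)
Lemma fast_sum n : M^-1 <= normc (om - 1) -> n%:R * tau <= T ->
  `|\sum_(j < n) K (j%:R * tau)| <= 20 * M ^+ 5 * tau.
Proof.
move=> nonres nT.
have jT j : (j <= n)%N -> 0 <= j%:R * tau <= T.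
  move=> jn; rewrite (mulr_ge0 _ (ltW tau_gt0)) //=; apply: le_trans nT.
  by rewrite ler_pM2r // ler_nat.
have jS j : j.+1%:R * tau = j%:R * tau + tau by rewrite -natr1 mulrDl mul1r.
pose al j := grad_p g (j%:R * tau) -i* grad_r g (j%:R * tau).
have -> : \sum_(j < n) K (j%:R * tau) =
    be^-1 * complex.Im (\sum_(j < n) al j * perp_vel (j%:R * tau)).
  rewrite -mulr_sumr; congr (_ * _).
  elim: n {nT jT} => [|n IH]; first by rewrite !big_ord0.
  by rewrite !big_ord_recr /= IH; case: (\sum_(i < n) al i * _) => a b /=; ring.
have Hal j : (j <= n)%N -> normc (al j) <= 2 * M.
  move=> /jT jn; apply: le_trans (normc_le _) _; rewrite /= normrN.
  have := tame_bound (grad_p_tame g) jn; have := tame_bound (grad_r_tame g) jn; lra.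
have stepT j : (j < n)%N -> 0 <= j%:R * tau /\ j%:R * tau + tau <= T.
  by move=> jn; have /andP[_] := jT _ jn; rewrite jS; have /andP[] := jT _ (ltnW jn).
have Hdal j : (j < n)%N -> normc (al j.+1 - al j) <= 2 * M * tau.
  move=> /stepT[h0 hT]; have le : j%:R * tau <= j%:R * tau + tau by rewrite lerDl ltW.
  apply: le_trans (normc_le _) _; rewrite /al jS /= -opprD normrN.
  have := tame_increment (grad_p_tame g) h0 le hT.
  have := tame_increment (grad_r_tame g) h0 le hT.
  by rewrite (_ : j%:R * tau + tau - j%:R * tau = tau); [lra|ring].
have Hy j : (j <= n)%N -> normc (perp_vel (j%:R * tau)) <= 2 * M by move=> /jT/perp_vel_bound.
have Hdy j : (j < n)%N ->
    normc (perp_vel (j.+1%:R * tau) - om * perp_vel (j%:R * tau)) <= 4 * M * tau.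
  by move=> /stepT[h0 hT]; rewrite jS; apply: velocity_step_crude.
have := oscillatory_sum (y := fun j => perp_vel (j%:R * tau)) Hal Hdal Hy Hdy.
set S := \sum_(j < n) _; rewrite normcM => HS.
rewrite normrM ger0_norm //.
rewrite (_ : 20 * M ^+ 5 * tau = M * tau * (20 * M ^+ 4)); last by ring.
apply: ler_pM => //; apply: le_trans (Im_le_normc _) _.
have {}HS : M^-1 * normc S <= 8 * M ^+ 2 + 12 * M ^+ 2 * (n%:R * tau).
  apply: le_trans (_ : normc (om - 1) * normc S <= _); last by apply: le_trans HS _; lra.
  by rewrite ler_wpM2r ?normc_ge0.
have Mp : 0 < M by apply: lt_le_trans M_ge1.
rewrite ler_pdivrMl // in HS; apply: le_trans HS _.
have M3 : M ^+ 3 <= M ^+ 4 by rewrite ler_weXn2l.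
have : M ^+ 3 * (n%:R * tau) <= M ^+ 3 * M by rewrite ler_wpM2l ?exprn_ge0 // (le_trans nT).
rewrite -exprSr.
rewrite (_ : M * _ = 8 * M ^+ 3 + 12 * (M ^+ 3 * (n%:R * tau))); last by ring.
by lra.
Qed.

(** The local errors of the trapezoidal rule for u are O(tau^2) each, but they
    cancel to the same order in the sum. *)
Lemma trapezoid_sum n : M^-1 <= normc (om - 1) -> n%:R * tau <= T ->
  `|par_vel g (n%:R * tau) - par_vel g (0%:R * tau) -
      tau / 2 * \sum_(j < n) (par_force g (j%:R * tau) + par_force g (j.+1%:R * tau))|
    <= 46 * M ^+ 5 * tau ^+ 2.
Proof.
move=> nonres nT.
have Mp : 0 < M by apply: lt_le_trans M_ge1.
have jS j : j.+1%:R * tau = j%:R * tau + tau by rewrite -natr1 mulrDl mul1r.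
have -> := @trapezoid_split _ tau (fun j => par_vel g (j%:R * tau))
  (fun j => V (j%:R * tau)) (fun j => W (j%:R * tau)) (fun j => par_force g (j%:R * tau))
  (fun j => G (j%:R * tau)) (fun j => K (j%:R * tau)) n
  (fun j => esym (subrK _ _)) (fun j => esym (subrK _ _)).
have jT j : (j <= n)%N -> 0 <= j%:R * tau <= T.
  move=> jn; rewrite (mulr_ge0 _ (ltW tau_gt0)) //=; apply: le_trans nT.
  by rewrite ler_pM2r // ler_nat.
have bW t : 0 <= t <= T -> `|W t| <= 2 * M ^+ 4 * tau ^+ 2.
  move=> tT; rewrite normrM normrN.
  rewrite (_ : 2 * M ^+ 4 * _ = (M * tau) ^+ 2 * (M * M + M * M)); last by ring.
  apply: ler_pM => //.
    by rewrite -exprVn ger0_norm ?exprn_ge0 // ler_pXn2r // nnegrE mulr_ge0 // ltW.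
  by apply: le_trans (ler_normD _ _) (lerD _ _); rewrite normrM ler_pM
    ?perp_vel1_bound ?perp_vel2_bound ?(tame_bound (grad_p_tame g))
    ?(tame_bound (grad_r_tame g)).
have bK t : 0 <= t <= T -> `|K t| <= 2 * M ^+ 3 * tau.
  move=> tT; rewrite normrM.
  rewrite (_ : 2 * M ^+ 3 * _ = M * tau * (M * M + M * M)); last by ring.
  apply: ler_pM => //; first by rewrite ger0_norm.
  by apply: le_trans (ler_normB _ _) (lerD _ _); rewrite normrM ler_pM
    ?perp_vel1_bound ?perp_vel2_bound ?(tame_bound (grad_p_tame g))
    ?(tame_bound (grad_r_tame g)).
have t0 := ltW tau_gt0.
rewrite (_ : 46 * M ^+ 5 * tau ^+ 2 = 16 * M ^+ 5 * tau ^+ 2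
  + (2 * M ^+ 5 * tau ^+ 2 + 2 * M ^+ 5 * tau ^+ 2)
  + (tau * (20 * M ^+ 5 * tau) + tau * (6 * M ^+ 5 * tau))); last by ring.
have Mle k : (k <= 5)%N -> M ^+ k <= M ^+ 5 by move=> ?; rewrite ler_weXn2l.
apply: le_trans (ler_normB _ _) (lerD _ _).
  apply: le_trans (ler_normD _ _) (lerD _ _); last first.
    have W5 t : 0 <= t <= T -> `|W t| <= 2 * M ^+ 5 * tau ^+ 2.
      by move/bW/le_trans; apply; rewrite ler_wpM2r ?exprn_ge0 // ler_wpM2l // Mle.
    apply: le_trans (ler_normB _ _) (lerD _ _); apply: W5; exact: jT.
  apply: le_trans (ler_norm_sum _ _ _) _.
  apply: le_trans (_ : \sum_(j < n) (16 * M ^+ 4 * tau ^+ 3) <= _).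
    apply: ler_sum => j _; rewrite jS.
    have /andP[h0 _] := jT _ (ltnW (ltn_ord j)).
    have /andP[_] := jT _ (ltn_ord j); rewrite jS => hT.
    apply: le_trans (slow_trapezoid h0 hT) _.
    rewrite ler_wpM2r ?exprn_ge0 //.
    have : M ^+ 2 <= M ^+ 4 by rewrite ler_weXn2l.
    by lra.
  rewrite sumr_const card_ord -[leLHS]mulr_natl.
  rewrite (_ : n%:R * _ = 16 * M ^+ 4 * tau ^+ 2 * (n%:R * tau)); last by ring.
  rewrite [leRHS](_ : _ = 16 * M ^+ 4 * tau ^+ 2 * M); last by ring.
  by rewrite ler_wpM2l ?mulr_ge0 ?exprn_ge0 // (le_trans nT).
apply: le_trans (ler_normD _ _) (lerD _ _).
  by rewrite normrM (ger0_norm t0) ler_wpM2l // fast_sum.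
rewrite normrM (ger0_norm (divr_ge0 t0 _)) // -mulrA ler_wpM2l //.
have b3 := Mle 3%N isT.
have {}bK t : 0 <= t <= T -> `|K t| <= 2 * M ^+ 5 * tau.
  by move/bK/le_trans; apply; rewrite ler_wpM2r // ler_wpM2l.
have := lerD (bK _ (jT _ (leqnn n))) (bK _ (jT _ (leq0n n))).
move=> /(le_trans (ler_normB _ _)) HK.
have M5 := mulr_ge0 (exprn_ge0 5 M_ge0) t0.
by rewrite mulrC; lra.
Qed.

End Consistency.

(** * Propagation of the errors *)

(** The implicit term k tau a_n is absorbed on the left, which costs the factor 2. *)
Lemma discrete_gronwall (R : realType) (a : nat -> R) (k c T tau : R) N :
  0 <= k -> 0 <= c -> 0 <= tau -> k * tau <= 1 / 2 -> N%:R * tau <= T ->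
  (forall n, (n <= N)%N -> 0 <= a n) ->
  (forall n, (n <= N)%N -> a n <= k * tau * \sum_(j < n.+1) a j + c) ->
  a N <= 2 * c * expR (2 * k * T).
Proof.
move=> k0 c0 tau0 small NT a0 Ha; pose b := 2 * k * tau.
have kt0 : 0 <= k * tau by rewrite mulr_ge0.
have b0 : 0 <= b by rewrite /b -mulrA mulr_ge0.
have Hb n : (n <= N)%N -> a n <= b * \sum_(j < n) a j + 2 * c.
  move=> nN; have := Ha n nN; rewrite big_ord_recr /= /b.
  have := a0 n nN; move: (\sum_(j < n) _) (a n) => S x x0 Hx.
  have : k * tau * x <= 1 / 2 * x by rewrite ler_wpM2r.
  by lra.
have Hn n : (n <= N)%N -> b * \sum_(j < n) a j + 2 * c <= 2 * c * (1 + b) ^+ n.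
  elim: n => [|n IH] nN; first by rewrite big_ord0 expr0; lra.
  have := IH (ltnW nN); have := Hb n (ltnW nN).
  rewrite big_ord_recr /= exprS; move: (\sum_(j < n) _) (a n) ((1 + b) ^+ n) => S x p.
  move=> h1 h2; have h3 := ler_wpM2l b0 h1.
  have h4 : (1 + b) * (b * S + 2 * c) <= (1 + b) * (2 * c * p).
    by rewrite ler_wpM2l // addr_ge0.
  by lra.
apply: le_trans (Hb N (leqnn N)) (le_trans (Hn N (leqnn N)) _).
rewrite ler_wpM2l ?mulr_ge0 //.
apply: le_trans (_ : expR b ^+ N <= _).
  by apply: lerXn2r; rewrite ?nnegrE ?expR_ge0 ?addr_ge0 ?expR_ge1Dx.
rewrite -expRM_natl ler_expR (_ : _ * b = 2 * k * (N%:R * tau)) ?/b; last by ring.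
by rewrite ler_wpM2l // mulr_ge0.
Qed.

Lemma pair_sum_le (R : realType) (a : nat -> R) n :
  (forall j, (j <= n)%N -> 0 <= a j) ->
  \sum_(j < n) (a j + a j.+1) <= 2 * \sum_(j < n.+1) a j.
Proof.
move=> a0; rewrite big_split /= mulr_natl mulr2n lerD //.
  by rewrite big_ord_recr /= lerDl a0.
by rewrite big_ord_recl /= lerDr a0.
Qed.

Lemma recursion_bound (R : realType) (s a : nat -> R) (k d : R) n :
  0 <= k -> (forall j, (j <= n)%N -> 0 <= a j) -> s 0%N = 0 ->
  (forall j, (j < n)%N -> s j.+1 <= s j + k * (a j + a j.+1) + d) ->
  s n <= 2 * k * \sum_(j < n.+1) a j + n%:R * d.
Proof.
move=> k0 a0 s0 Hs.
suff Hn m : (m <= n)%N -> s m <= k * \sum_(j < m) (a j + a j.+1) + m%:R * d.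
  apply: le_trans (Hn n (leqnn n)) _.
  have := ler_wpM2l k0 (pair_sum_le a0); lra.
elim: m => [|m IH] mn; first by rewrite s0 big_ord0 !(mulr0, mul0r) addr0.
apply: le_trans (Hs m mn) _; rewrite big_ord_recr /= -natr1.
by have := IH (ltnW mn); lra.
Qed.

(** Errors of the scalar recursions.  The bounds have the form of a multiple of
    A n, the sum of the position errors up to n, plus a consistency error; they
    are closed in position_error. *)
Section Errors.
Context {R : realType} (T M be tau : R).
Hypotheses (M_ge1 : 1 <= M) (TM : T <= M) (be_gt0 : 0 < be) (tau_gt0 : 0 < tau)
  (be_inv : be^-1 <= M * tau) (tau_le : 16 * M ^+ 4 * tau <= 1).
Variable g : gyromotion T M be.
Local Notation om := (cexp (0 +i* (be * tau))).
Local Notation ib := (0 +i* be : R[i]).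
Hypothesis nonres : M^-1 <= normc (om - 1).

Variables (N : nat) (xn un Fn : nat -> R) (Qn yn en : nat -> R[i]) (a : nat -> R).
Variables (phm php al bt : R[i]) (al0 bt0 : R).
Local Notation t j := (j%:R * tau).

Hypotheses (NT : t N <= T)
  (x0 : xn 0%N = par_pos g (t 0%N)) (u0 : un 0%N = par_vel g (t 0%N))
  (Q0 : Qn 0%N = perp_pos g (t 0%N)) (y0 : yn 0%N = perp_vel g (t 0%N))
  (phi_bound : normc phm <= M /\ normc php <= M)
  (ab_bound : normc al <= 2 * M ^+ 2 /\ normc bt <= 2 * M ^+ 2)
  (ab0_bound : `|al0| <= 2 * M ^+ 2 /\ `|bt0| <= 2 * M ^+ 2)
  (phi_sum : tau%:C / 2 * (phm + php) = (om - 1) / ib)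
  (ab_sum : tau%:C ^+ 2 / 4 * (al + bt) = ((om - 1) / ib - tau%:C) / ib)
  (ab0_sum : al0 + bt0 = 2).

Hypotheses
  (x_step : forall j, (j < N)%N ->
     xn j.+1 = xn j + tau * un j + tau ^+ 2 / 4 * (al0 * Fn j + bt0 * Fn j.+1))
  (u_step : forall j, (j < N)%N -> un j.+1 = un j + tau / 2 * (Fn j + Fn j.+1))
  (Q_step : forall j, (j < N)%N ->
     Qn j.+1 = Qn j + (om - 1) / ib * yn j
       + tau%:C ^+ 2 / 4 * (al * en j + bt * en j.+1))
  (y_step : forall j, (j < N)%N ->
     yn j.+1 = om * yn j + tau%:C / 2 * (phm * en j + php * en j.+1)).

Hypotheses (a_ge0 : forall j, 0 <= a j)
  (F_err : forall j, (j <= N)%N -> `|par_force g (t j) - Fn j| <= M * a j)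
  (e_err : forall j, (j <= N)%N -> normc (perp_force g (t j) - en j) <= M * a j)
  (a_le : forall j, (j <= N)%N ->
     a j <= `|par_pos g (t j) - xn j| + normc (perp_pos g (t j) - Qn j)).

Let M_ge0 : 0 <= M. Proof. exact: le_trans M_ge1. Qed.
Let tau_ge0 : 0 <= tau. Proof. exact: ltW. Qed.
Let ib_neq0 : ib != 0. Proof. by rewrite imag_neq0 // gt_eqF. Qed.
Let A n := \sum_(j < n.+1) a j.
Let Mle k l : (k <= l)%N -> M ^+ k <= M ^+ l. Proof. by move=> ?; rewrite ler_weXn2l. Qed.

Let tT j : (j <= N)%N -> t j <= T.
Proof. by move=> jN; apply: le_trans NT; rewrite ler_wpM2r // ler_nat. Qed.
Let tS j : t j.+1 = t j + tau. Proof. by rewrite -natr1 mulrDl mul1r. Qed.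
Let t_ge0 j : 0 <= t j. Proof. by rewrite mulr_ge0. Qed.
Let tST j : (j < N)%N -> t j + tau <= T. Proof. by move=> /tT; rewrite tS. Qed.

Let normc_ib : normc ib^-1 <= M * tau.
Proof. by rewrite normcV normc_imag gtr0_norm. Qed.

Let normc_half : normc (tau%:C / 2) = tau / 2.
Proof.
rewrite (_ : tau%:C / 2 = (tau / 2)%:C) ?normc_real ?ger0_norm ?divr_ge0 //.
by rewrite -[2]/((2%:R : R[i])) -(rmorph_nat (real_complex R)) -fmorph_div.
Qed.

Let normc_quarter : normc (tau%:C ^+ 2 / 4) = tau ^+ 2 / 4.
Proof.
rewrite (_ : tau%:C ^+ 2 / 4 = (tau ^+ 2 / 4)%:C) ?normc_real ?ger0_norm ?divr_ge0 ?sqr_ge0 //.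
by rewrite -[4]/((4%:R : R[i])) -(rmorph_nat (real_complex R)) fmorph_div rmorphXn.
Qed.

(** Summing the trapezoidal rule over all steps before estimating is what gives
    access to the cancellation in trapezoid_sum. *)
Lemma u_error n : (n <= N)%N ->
  `|par_vel g (t n) - un n| <= M * tau * A n + 46 * M ^+ 5 * tau ^+ 2.
Proof.
move=> nN.
have -> : un n = un 0%N + tau / 2 * \sum_(j < n) (Fn j + Fn j.+1).
  elim: n nN => [|n IH] nN; first by rewrite big_ord0 mulr0 addr0.
  by rewrite big_ord_recr /= u_step // (IH (ltnW nN)); ring.
have H := trapezoid_sum M_ge1 TM be_gt0 tau_gt0 be_inv g nonres (tT nN).
rewrite u0 (_ : _ - _ = (par_vel g (t n) - par_vel g (t 0%N) -
      tau / 2 * \sum_(j < n) (par_force g (t j) + par_force g (t j.+1))) + tau / 2 *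
      \sum_(j < n) ((par_force g (t j) - Fn j) + (par_force g (t j.+1) - Fn j.+1))); last first.
  by rewrite !big_split /= !sumrN; ring.
rewrite addrC; apply: le_trans (ler_normD _ _) (lerD _ H).
rewrite normrM ger0_norm ?divr_ge0 //.
rewrite (_ : M * tau * A n = tau / 2 * (M * (2 * A n))); last by field.
rewrite ler_wpM2l ?divr_ge0 //; apply: le_trans (ler_norm_sum _ _ _) _.
apply: le_trans (_ : \sum_(j < n) (M * (a j + a j.+1)) <= _).
  apply: ler_sum => j _; rewrite mulrDr; apply: le_trans (ler_normD _ _) (lerD _ _).
    by apply: F_err; rewrite (leq_trans (ltnW (ltn_ord j))).
  by apply: F_err; rewrite (leq_trans (ltn_ord j)).
by rewrite -mulr_sumr ler_wpM2l // pair_sum_le.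
Qed.

Lemma y_error n : (n <= N)%N ->
  normc (perp_vel g (t n) - yn n) <= 2 * M ^+ 3 * tau * A n + 6 * M ^+ 3 * tau.
Proof.
move=> nN.
have Hstep j : (j < n)%N -> normc (perp_vel g (t j.+1) - yn j.+1) <=
    normc (perp_vel g (t j) - yn j) + M ^+ 2 / 2 * tau * (a j + a j.+1) + 5 * M ^+ 2 * tau ^+ 2.
  move=> jn; have jN := leq_trans jn nN; rewrite y_step // tS.
  have H := velocity_step M_ge1 be_gt0 tau_gt0 g (t_ge0 j) (tST jN).
  rewrite -phi_sum in H.
  have E1 := e_err (ltnW jN); have E2 := e_err jN; rewrite tS in E2.
  have Ed := perp_force_increment g (t_ge0 j) (_ : t j <= t j + tau) (tST jN).
  rewrite lerDl (_ : t j + tau - t j = tau) in Ed; last by ring.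
  have {}Ed := Ed tau_ge0.
  rewrite (_ : _ - _ = om * (perp_vel g (t j) - yn j) + tau%:C / 2 *
    (phm * (perp_force g (t j) - en j) + php * (perp_force g (t j + tau) - en j.+1))
    + (perp_vel g (t j + tau) - om * perp_vel g (t j)
       - tau%:C / 2 * (phm + php) * perp_force g (t j)
       - tau%:C / 2 * (php * (perp_force g (t j + tau) - perp_force g (t j))))); last by ring.
  apply: le_trans (normcD _ _) (lerD (le_trans (normcD _ _) (lerD _ _)) _).
  - by rewrite normcM normc_cexp_imag mul1r.
  - rewrite normcM normc_half (_ : _ * (a j + _) =
      tau / 2 * (M * (M * a j) + M * (M * a j.+1))); last by field.
    rewrite ler_wpM2l ?divr_ge0 //; case: phi_bound => p1 p2.
    by apply: le_trans (normcD _ _) (lerD _ _); rewrite normcM ler_pM ?normc_ge0.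
  - apply: le_trans (normcB _ _) _; rewrite normcM normc_half normcM.
    case: phi_bound => p1 p2.
    have := ler_pM (normc_ge0 _) (normc_ge0 _) p2 Ed.
    have M1 : M * tau ^+ 2 <= M ^+ 2 * tau ^+ 2.
      by rewrite ler_wpM2r ?sqr_ge0 // ler_eXnr.
    move=> /(ler_wpM2l (divr_ge0 tau_ge0 (ler0n _ 2))).
    by lra.
apply: le_trans (recursion_bound (k := M ^+ 2 / 2 * tau) _ _ _ Hstep) _ => //.
- by rewrite mulr_ge0 // divr_ge0 ?sqr_ge0.
- by rewrite y0 subrr normc0.
have A0 : 0 <= A n by rewrite sumr_ge0.
apply: lerD.
  rewrite ler_wpM2r // (_ : 2 * (M ^+ 2 / 2 * tau) = M ^+ 2 * tau); last by field.
  rewrite ler_wpM2r //; have := Mle (isT : 2 <= 3)%N; have := exprn_ge0 2 M_ge0; lra.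
rewrite (_ : n%:R * _ = 5 * M ^+ 2 * tau * t n); last by ring.
apply: le_trans (_ : 5 * M ^+ 2 * tau * M <= _).
  by rewrite ler_wpM2l ?mulr_ge0 ?sqr_ge0 // (le_trans (tT nN)).
have := mulr_ge0 (exprn_ge0 3 M_ge0) tau_ge0; lra.
Qed.

(** Eliminating y from the numerical guiding center leaves the forces with the
    weights al' and bt', whose sum -tau/(i beta) is that of the exact law. *)
Lemma center_error n : (n <= N)%N ->
  normc (guiding_center g (t n) - (Qn n - yn n / ib)) <=
    2 * M ^+ 3 * tau ^+ 2 * A n + 4 * M ^+ 4 * tau ^+ 2.
Proof.
move=> nN.
pose al' := tau%:C ^+ 2 / 4 * al - tau%:C / 2 * phm / ib.
pose bt' := tau%:C ^+ 2 / 4 * bt - tau%:C / 2 * php / ib.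
have weight (x y : R[i]) : normc x <= M -> normc y <= 2 * M ^+ 2 ->
    normc (tau%:C ^+ 2 / 4 * y - tau%:C / 2 * x / ib) <= M ^+ 2 * tau ^+ 2.
  move=> Hx Hy; rewrite (_ : _ * _ ^+ 2 =
    tau ^+ 2 / 4 * (2 * M ^+ 2) + tau / 2 * M * (M * tau)); last by field.
  apply: le_trans (normcB _ _) (lerD _ _).
    by rewrite normcM normc_quarter ler_wpM2l // divr_ge0 ?sqr_ge0.
  rewrite normcM normcM normc_half ler_pM ?mulr_ge0 ?normc_ge0 ?divr_ge0 //.
  by rewrite ler_wpM2l ?divr_ge0.
have al_le : normc al' <= M ^+ 2 * tau ^+ 2.
  by case: phi_bound => ? _; case: ab_bound => ? _; apply: weight.
have bt_le : normc bt' <= M ^+ 2 * tau ^+ 2.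
  by case: phi_bound => _ ?; case: ab_bound => _ ?; apply: weight.
have Hstep j : (j < n)%N -> normc (guiding_center g (t j.+1) - (Qn j.+1 - yn j.+1 / ib)) <=
    normc (guiding_center g (t j) - (Qn j - yn j / ib)) + M ^+ 3 * tau ^+ 2 * (a j + a j.+1)
      + 4 * M ^+ 3 * tau ^+ 3.
  move=> jn; have jN := leq_trans jn nN; rewrite y_step // Q_step // tS.
  have H := center_step M_ge1 be_gt0 tau_gt0 be_inv g (t_ge0 j) (tST jN).
  have E1 := e_err (ltnW jN); have E2 := e_err jN; rewrite tS in E2.
  have Ed := perp_force_increment g (t_ge0 j) (_ : t j <= t j + tau) (tST jN).
  rewrite lerDl (_ : t j + tau - t j = tau) in Ed; last by ring.
  have {}Ed := Ed tau_ge0.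
  have sum' : al' + bt' = - (tau%:C / ib).
    rewrite (_ : al' + bt' =
      tau%:C ^+ 2 / 4 * (al + bt) - tau%:C / 2 * (phm + php) / ib); last by rewrite /al' /bt'; ring.
    by rewrite ab_sum phi_sum; field.
  rewrite (_ : _ - _ = (guiding_center g (t j) - (Qn j - yn j / ib)) +
    (al' * (perp_force g (t j) - en j) + bt' * (perp_force g (t j + tau) - en j.+1))
    + ((guiding_center g (t j + tau) - guiding_center g (t j)
        - (al' + bt') * perp_force g (t j))
       - bt' * (perp_force g (t j + tau) - perp_force g (t j)))); last first.
    by rewrite /al' /bt'; field.
  apply: le_trans (normcD _ _) (lerD (le_trans (normcD _ _) (lerD _ _)) _) => //.
  - rewrite (_ : _ * (a j + _) =
      M ^+ 2 * tau ^+ 2 * (M * a j) + M ^+ 2 * tau ^+ 2 * (M * a j.+1)); last by ring.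
    by apply: le_trans (normcD _ _) (lerD _ _); rewrite normcM ler_pM ?normc_ge0.
  - rewrite sum' mulNr opprK mulrAC.
    apply: le_trans (normcB _ _) _.
    apply: le_trans (lerD H (_ : _ <= M ^+ 2 * tau ^+ 2 * (2 * M * tau))) _.
      by rewrite normcM ler_pM ?normc_ge0.
    have : M ^+ 2 * tau ^+ 3 <= M ^+ 3 * tau ^+ 3.
      by rewrite ler_wpM2r ?exprn_ge0 // Mle.
    by lra.
apply: le_trans (recursion_bound (k := M ^+ 3 * tau ^+ 2) _ _ _ Hstep) _ => //.
- by rewrite mulr_ge0 ?exprn_ge0.
- by rewrite /guiding_center Q0 y0 subrr normc0.
rewrite [leLHS](_ : _ =
  2 * M ^+ 3 * tau ^+ 2 * A n + 4 * M ^+ 3 * tau ^+ 2 * t n); last by rewrite /A; ring.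
rewrite lerD2l [leRHS](_ : _ = 4 * M ^+ 3 * tau ^+ 2 * M); last by ring.
by rewrite ler_wpM2l ?mulr_ge0 ?exprn_ge0 // (le_trans (tT nN)).
Qed.

Lemma x_error n : (n <= N)%N ->
  `|par_pos g (t n) - xn n| <=
    (M ^+ 3 * tau ^+ 2 + M ^+ 2 * tau) * A n + 51 * M ^+ 6 * tau ^+ 2.
Proof.
move=> nN.
have A0 : 0 <= A n by rewrite sumr_ge0.
have Amono j : (j <= n)%N -> A j <= A n.
  move=> jn; rewrite /A (big_ord_widen n.+1 a) //.
  by rewrite [leRHS](bigID (fun i : 'I_n.+1 => (i < j.+1)%N)) /= lerDl sumr_ge0.
have Hstep j : (j < n)%N -> `|par_pos g (t j.+1) - xn j.+1| <=
    `|par_pos g (t j) - xn j| + M ^+ 3 / 2 * tau ^+ 2 * (a j + a j.+1)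
      + (M * tau ^+ 2 * A n + 51 * M ^+ 5 * tau ^+ 3).
  move=> jn; have jN := leq_trans jn nN; rewrite x_step // tS.
  have H := parallel_step M_ge1 tau_gt0 g (t_ge0 j) (tST jN).
  have Hu := u_error (ltnW jN).
  have E1 := F_err (ltnW jN); have E2 := F_err jN; rewrite tS in E2.
  have Ed := par_force_increment g (t_ge0 j) (_ : t j <= t j + tau) (tST jN).
  rewrite lerDl (_ : t j + tau - t j = tau) in Ed; last by ring.
  have {}Ed := Ed tau_ge0.
  have [a0_le b0_le] := ab0_bound.
  rewrite (_ : _ - _ = (par_pos g (t j) - xn j) + tau ^+ 2 / 4 *
     (al0 * (par_force g (t j) - Fn j) + bt0 * (par_force g (t j + tau) - Fn j.+1))
    + (tau * (par_vel g (t j) - un j)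
       + (par_pos g (t j + tau) - par_pos g (t j)
         - (par_vel g (t j) * tau + par_force g (t j) * tau ^+ 2 / 2)
       - tau ^+ 2 / 4 * (bt0 * (par_force g (t j + tau) - par_force g (t j)))))); last first.
    have -> : al0 = 2 - bt0 by rewrite -ab0_sum; ring.
    by field.
  have q0 : 0 <= tau ^+ 2 / 4 by rewrite divr_ge0 ?sqr_ge0.
  apply: le_trans (ler_normD _ _) (lerD (le_trans (ler_normD _ _) (lerD _ _)) _) => //.
  - rewrite normrM (ger0_norm q0).
    rewrite (_ : _ * (a j + _) =
      tau ^+ 2 / 4 * (2 * M ^+ 2 * (M * a j) + 2 * M ^+ 2 * (M * a j.+1))); last by field.
    rewrite ler_wpM2l //.
    by apply: le_trans (ler_normD _ _) (lerD _ _); rewrite normrM ler_pM.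
  - apply: le_trans (ler_normD _ _) _; rewrite normrM (ger0_norm tau_ge0).
    have {}Hu : tau * `|par_vel g (t j) - un j| <= M * tau ^+ 2 * A n + 46 * M ^+ 5 * tau ^+ 3.
      rewrite [leRHS](_ : _ = tau * (M * tau * A n + 46 * M ^+ 5 * tau ^+ 2)); last by ring.
      rewrite ler_wpM2l //; apply: le_trans Hu _; rewrite lerD2r ler_wpM2l ?mulr_ge0 //.
      exact/Amono/ltnW.
    have D : `|tau ^+ 2 / 4 * (bt0 * (par_force g (t j + tau) - par_force g (t j)))|
        <= tau ^+ 2 / 4 * (2 * M ^+ 2 * (3 * M ^+ 2 * tau)).
      by rewrite normrM (ger0_norm q0) ler_wpM2l // normrM ler_pM.
    have := le_trans (ler_normB _ _) (lerD H D).
    have t3 : 0 <= tau ^+ 3 by rewrite exprn_ge0.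
    have m2 := ler_wpM2r t3 (Mle (isT : 2 <= 5)%N).
    have m4 := ler_wpM2r t3 (Mle (isT : 4 <= 5)%N).
    rewrite (_ : tau ^+ 2 / 4 * (2 * M ^+ 2 * (3 * M ^+ 2 * tau)) =
      3 / 2 * (M ^+ 4 * tau ^+ 3)); last by field.
    have m5 := mulr_ge0 (exprn_ge0 5 M_ge0) t3.
    by lra.
apply: le_trans (recursion_bound (k := M ^+ 3 / 2 * tau ^+ 2) _ _ _ Hstep) _ => //.
- by rewrite mulr_ge0 ?divr_ge0 ?exprn_ge0.
- by rewrite x0 subrr normr0.
rewrite (_ : 2 * (M ^+ 3 / 2 * tau ^+ 2) = M ^+ 3 * tau ^+ 2); last by field.
rewrite [leRHS](_ : _ =
  M ^+ 3 * tau ^+ 2 * A n + (M * tau * A n + 51 * M ^+ 5 * tau ^+ 2) * M); last by ring.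
rewrite lerD2l [leLHS](_ : _ = (M * tau * A n + 51 * M ^+ 5 * tau ^+ 2) * t n); last by ring.
rewrite ler_wpM2l ?addr_ge0 ?mulr_ge0 ?exprn_ge0 //.
exact: le_trans (tT nN) TM.
Qed.

(** The error of Q is that of the guiding center plus that of y divided by i beta,
    and the second is damped by 1/beta <= M tau. *)
Lemma position_error n : (n <= N)%N ->
  a n <= 122 * M ^+ 6 * expR (16 * M ^+ 5) * tau ^+ 2.
Proof.
move=> nN.
have M4 : 1 <= M ^+ 4 by rewrite exprn_ege1.
have tau1 : tau <= 1.
  have : tau <= M ^+ 4 * tau by rewrite ler_peMl.
  by move: tau_le; lra.
have M4p : 0 <= M ^+ 4 by rewrite exprn_ge0.
have M6p : 0 <= M ^+ 6 by rewrite exprn_ge0.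
have t2 : 0 <= tau ^+ 2 by rewrite sqr_ge0.
have key j : (j <= n)%N ->
    a j <= 8 * M ^+ 4 * tau * \sum_(i < j.+1) a i + 61 * M ^+ 6 * tau ^+ 2.
  move=> jn; have jN := leq_trans jn nN; rewrite -/(A j).
  have A0 : 0 <= A j by rewrite sumr_ge0.
  have Hx := x_error jN; have Hw := center_error jN; have Hy := y_error jN.
  have HQ : normc (perp_pos g (t j) - Qn j) <=
      normc (guiding_center g (t j) - (Qn j - yn j / ib))
      + normc (perp_vel g (t j) - yn j) * (M * tau).
    rewrite (_ : perp_pos g (t j) - Qn j = (guiding_center g (t j) - (Qn j - yn j / ib))
      + (perp_vel g (t j) - yn j) / ib); last by rewrite /guiding_center; ring.
    apply: le_trans (normcD _ _) (lerD (lexx _) _).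
    by rewrite normcM ler_wpM2l ?normc_ge0.
  have {}Hy := ler_wpM2r (mulr_ge0 M_ge0 tau_ge0) Hy.
  apply: le_trans (a_le jN) (le_trans (lerD Hx (le_trans HQ (lerD Hw Hy))) _).
  have tau2 : tau ^+ 2 <= tau by rewrite ler_iXnr.
  have tA : tau ^+ 2 * A j <= tau * A j by rewrite ler_wpM2r.
  have c1 := ler_pM (exprn_ge0 3 M_ge0) (mulr_ge0 t2 A0) (Mle (isT : 3 <= 4)%N) tA.
  have c2 := ler_wpM2l M4p tA.
  have c3 := ler_wpM2r (mulr_ge0 tau_ge0 A0) (Mle (isT : 2 <= 4)%N).
  have c4 := ler_wpM2r t2 (Mle (isT : 4 <= 6)%N).
  have c5 := mulr_ge0 (mulr_ge0 M4p tau_ge0) A0.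
  by lra.
apply: le_trans (discrete_gronwall (k := 8 * M ^+ 4) (c := 61 * M ^+ 6 * tau ^+ 2)
  (T := T) (tau := tau) _ _ tau_ge0 _ (tT nN) (fun j _ => a_ge0 j) key) _.
- by rewrite mulr_ge0.
- by rewrite !mulr_ge0.
- by move: tau_le; lra.
rewrite [leRHS](_ : _ = 2 * (61 * M ^+ 6 * tau ^+ 2) * expR (16 * M ^+ 5)); last by ring.
rewrite ler_wpM2l ?mulr_ge0 // ler_expR.
rewrite [leRHS](_ : _ = 2 * (8 * M ^+ 4) * M); last by ring.
by rewrite ler_wpM2l ?mulr_ge0.
Qed.

(** The first summand carries the Gronwall constant of position_error, which the
    velocity bounds multiply by at most 4 M^4; the second is the consistency error. *)
Definition error_const := 4 * M ^+ 4 * (122 * M ^+ 6 * expR (16 * M ^+ 5)) + 46 * M ^+ 5.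

Lemma scalar_errors : [/\ a N <= error_const * tau ^+ 2,
  `|par_vel g (t N) - un N| <= error_const * tau ^+ 2 &
  normc (perp_vel g (t N) - yn N) <= error_const * tau].
Proof.
have := position_error (leqnn N); rewrite /error_const.
set C1 := 122 * _ * _ => Ha.
have C1p : 0 <= C1 by rewrite !mulr_ge0 ?expR_ge0 ?exprn_ge0.
have M4p : 1 <= M ^+ 4 by rewrite exprn_ege1.
have M5p : 1 <= M ^+ 5 by rewrite exprn_ege1.
have M0p : 0 <= M ^+ 4 by rewrite exprn_ge0.
have tau1 : tau <= 1.
  have : tau <= M ^+ 4 * tau by rewrite ler_peMl.
  by move: tau_le; lra.
have t2 : 0 <= tau ^+ 2 by rewrite sqr_ge0.
have HA : tau * A N <= 2 * M * C1 * tau ^+ 2.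
  apply: le_trans (_ : tau * \sum_(j < N.+1) (C1 * tau ^+ 2) <= _).
    rewrite ler_wpM2l // ler_sum // => j _; apply: position_error.
    by rewrite -ltnS.
  rewrite sumr_const card_ord -[X in tau * X]mulr_natl.
  rewrite [leLHS](_ : _ = (t N + tau) * (C1 * tau ^+ 2)); last by rewrite -natr1; ring.
  rewrite -[leRHS]mulrA ler_wpM2r ?mulr_ge0 //.
  rewrite (_ : 2 * M = M + M); [|by ring]; apply: lerD; first exact: le_trans NT TM.
  exact: le_trans tau1 M_ge1.
have A0 : 0 <= tau * A N by rewrite mulr_ge0 // sumr_ge0.
have C4 : C1 <= M ^+ 4 * C1 by rewrite ler_peMl.
have C2 := ler_wpM2r C1p (Mle (isT : 2 <= 4)%N).
split.
- apply: le_trans Ha _; rewrite ler_wpM2r //.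
  have := exprn_ge0 5 M_ge0; lra.
- apply: le_trans (u_error (leqnn N)) _; rewrite [leRHS]mulrDl lerD2r.
  have := ler_wpM2l M_ge0 HA; have := ler_wpM2r t2 C2.
  have := mulr_ge0 C1p t2; have := mulr_ge0 (mulr_ge0 M0p C1p) t2; lra.
- apply: le_trans (y_error (leqnn N)) _; rewrite [leRHS]mulrDl; apply: lerD.
    have := ler_wpM2l (exprn_ge0 3 M_ge0) HA.
    have : M ^+ 4 * C1 * tau ^+ 2 <= M ^+ 4 * C1 * tau.
      by rewrite ler_wpM2l ?mulr_ge0 // ler_iXnr.
    lra.
  rewrite ler_wpM2r //; have := Mle (isT : 3 <= 5)%N; have := exprn_ge0 5 M_ge0; lra.
Qed.

End Errors.

(** * A frame adapted to the field *)

Section Space.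
Context {R : realType}.
Implicit Types u v w x y B b p r : 'cV[R]_3.

Definition dot n (u x : 'cV[R]_n) : R := \sum_i u i 0 * x i 0.

Lemma sum3 (V : nmodType) (f : 'I_3 -> V) : \sum_i f i = f 0 + f 1 + f 2.
Proof.
rewrite !big_ord_recr big_ord0 /= add0r.
by congr (f _ + f _ + f _); apply: val_inj.
Qed.

Lemma dotE u x : dot u x = u 0 0 * x 0 0 + u 1 0 * x 1 0 + u 2 0 * x 2 0.
Proof. by rewrite /dot sum3. Qed.

Lemma crossvE u w : [/\ crossv u w 0 0 = u 1 0 * w 2 0 - u 2 0 * w 1 0,
  crossv u w 1 0 = u 2 0 * w 0 0 - u 0 0 * w 2 0 &
  crossv u w 2 0 = u 0 0 * w 1 0 - u 1 0 * w 0 0].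
Proof.
have e0 : (1 + 1 : 'I_3) = 2 by apply: val_inj.
have e1 : (1 + 2 : 'I_3) = 0 by apply: val_inj.
have e2 : (2 + 1 : 'I_3) = 0 by apply: val_inj.
have e3 : (2 + 2 : 'I_3) = 1 by apply: val_inj.
by split; rewrite mxE ?add0r ?e0 ?e1 ?e2 ?e3.
Qed.

Lemma dotDr n (u x y : 'cV[R]_n) : dot u (x + y) = dot u x + dot u y.
Proof. by rewrite /dot -big_split; apply: eq_bigr => i _; rewrite mxE mulrDr. Qed.

Lemma dotZr n (u x : 'cV[R]_n) c : dot u (c *: x) = c * dot u x.
Proof. by rewrite /dot mulr_sumr; apply: eq_bigr => i _; rewrite mxE mulrCA. Qed.

Lemma dotBr n (u x y : 'cV[R]_n) : dot u (x - y) = dot u x - dot u y.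
Proof. by rewrite -scaleN1r dotDr dotZr mulN1r. Qed.

Lemma dotC n (u x : 'cV[R]_n) : dot u x = dot x u.
Proof. by apply: eq_bigr => i _; rewrite mulrC. Qed.

Lemma enorm_ge0 n (x : 'cV[R]_n) : 0 <= enorm x.
Proof. exact: sqrtr_ge0. Qed.

Lemma enorm_sqr n (x : 'cV[R]_n) : enorm x ^+ 2 = dot x x.
Proof. by rewrite sqr_sqrtr //; apply: sumr_ge0 => i _; rewrite sqr_ge0. Qed.

Lemma dot_eq0 n (x : 'cV[R]_n) : dot x x = 0 -> x = 0.
Proof.
move=> /eqP; rewrite psumr_eq0 => [/allP H|i _]; last by rewrite -expr2 sqr_ge0.
apply/colP => i; rewrite mxE; have := H i (mem_index_enum i).
by rewrite -expr2 sqrf_eq0 => /eqP.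
Qed.

Lemma dot_cross_cross p b v w :
  dot (crossv p b) (crossv v w) = dot p v * dot b w - dot p w * dot b v.
Proof.
rewrite !dotE; have [-> -> ->] := crossvE p b; have [-> -> ->] := crossvE v w.
by ring.
Qed.

(** An orthonormal frame in which v |-> v x B is a rotation generator in the plane
    of p and r, together with the consequences that are used. *)
Record frame B b p r : Prop := Frame {
  frame_axis : B = enorm B *: b;
  frame_bb : dot b b = 1; frame_pp : dot p p = 1; frame_rr : dot r r = 1;
  frame_bp : dot b p = 0; frame_br : dot b r = 0; frame_pr : dot p r = 0;
  frame_b_cross : forall v, dot b (crossv v B) = 0;
  frame_p_cross : forall v, dot p (crossv v B) = - (enorm B * dot r v);
  frame_r_cross : forall v, dot r (crossv v B) = enorm B * dot p v;
  frame_parseval : forall x, dot x x = dot b x ^+ 2 + dot p x ^+ 2 + dot r x ^+ 2 }.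

(** Rotate the first two coordinates of b by a right angle; if they vanish, the
    first basis vector is orthogonal to b. *)
Lemma unit_orthogonal b : exists2 p, dot p p = 1 & dot b p = 0.
Proof.
have [b0|b0] := eqVneq (b 0 0 ^+ 2 + b 1 0 ^+ 2) 0.
  exists (delta_mx 0 0); rewrite dotE !mxE /=; first by ring.
  move/eqP: b0; rewrite paddr_eq0 ?sqr_ge0 // !sqrf_eq0 => /andP[/eqP -> _].
  by ring.
pose p0 : 'cV[R]_3 := b 1 0 *: delta_mx 0 0 - b 0 0 *: delta_mx 1 0.
have pp : dot p0 p0 = b 0 0 ^+ 2 + b 1 0 ^+ 2 by rewrite dotE !mxE /=; ring.
have bp : dot b p0 = 0 by rewrite dotE !mxE /=; ring.
have c0 : 0 <= b 0 0 ^+ 2 + b 1 0 ^+ 2 by rewrite addr_ge0 ?sqr_ge0.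
exists ((Num.sqrt (b 0 0 ^+ 2 + b 1 0 ^+ 2))^-1 *: p0).
  by rewrite dotZr dotC dotZr mulrA -expr2 exprVn sqr_sqrtr // pp mulVf.
by rewrite dotZr bp mulr0.
Qed.

Lemma exists_frame B : 0 < enorm B -> exists b p r, frame B b p r.
Proof.
move=> B0; pose b := (enorm B)^-1 *: B; have [p pp bp] := unit_orthogonal b.
have axis : B = enorm B *: b by rewrite scalerA divff ?scale1r // gt_eqF.
have bb : dot b b = 1.
  by rewrite dotZr dotC dotZr mulrA -enorm_sqr -expr2 exprVn mulVf // expf_neq0 ?gt_eqF.
have crossZ v : crossv v B = enorm B *: crossv v b.
  by rewrite {1}axis; apply/colP => i; rewrite !mxE; ring.
exists b, p, (crossv p b); split=> //.
- by rewrite dot_cross_cross pp bb bp dotC bp; ring.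
- by rewrite dotE; have [-> -> ->] := crossvE p b; ring.
- by rewrite dotE; have [-> -> ->] := crossvE p b; ring.
- by move=> v; rewrite crossZ dotZr dotE; have [-> -> ->] := crossvE v b; ring.
- move=> v; rewrite crossZ dotZr !dotE; have [-> -> ->] := crossvE v b.
  by have [-> -> ->] := crossvE p b; ring.
- by move=> v; rewrite crossZ dotZr dot_cross_cross bb dotC [dot p b]dotC bp dotC; ring.
- move=> x.
  (* The square of the triple product is the Gram determinant of p, b, x. *)
  have H : dot (crossv p b) x ^+ 2 = dot p p * dot b b * dot x x
     + 2 * dot b p * dot b x * dot p x - dot p p * dot b x ^+ 2
     - dot b b * dot p x ^+ 2 - dot x x * dot b p ^+ 2.
    by rewrite !dotE; have [-> -> ->] := crossvE p b; ring.
  by rewrite H pp bb bp; ring.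
Qed.

Section InFrame.
Variables (B b p r : 'cV[R]_3).
Hypothesis fr : frame B b p r.

Lemma frame_decomp x : x = dot b x *: b + dot p x *: p + dot r x *: r.
Proof.
apply/eqP; rewrite -subr_eq0; apply/eqP/dot_eq0.
rewrite (frame_parseval fr) !(dotBr, dotDr, dotZr) [dot p b]dotC [dot r b]dotC [dot r p]dotC.
rewrite (frame_bb fr) (frame_pp fr) (frame_rr fr) (frame_bp fr) (frame_br fr) (frame_pr fr).
by ring.
Qed.

Lemma enorm_frame x :
  enorm x = Num.sqrt (dot b x ^+ 2 + normc (dot p x +i* dot r x) ^+ 2).
Proof.
rewrite /= sqr_sqrtr ?addr_ge0 ?sqr_ge0 // addrA -(frame_parseval fr).
by rewrite -enorm_sqr sqrtr_sqr ger0_norm ?enorm_ge0.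
Qed.

Lemma enorm_frame_le x : enorm x <= `|dot b x| + normc (dot p x +i* dot r x).
Proof.
rewrite enorm_frame -[leRHS]ger0_norm ?addr_ge0 ?normc_ge0 // -sqrtr_sqr.
rewrite ler_wsqrtr // sqrrD real_normK ?num_real // lerD2r lerDl.
by rewrite mulrn_wge0 // mulr_ge0 ?normc_ge0.
Qed.

Lemma dot_b_le x : `|dot b x| <= enorm x.
Proof. by rewrite enorm_frame -[`|_|]sqrtr_sqr ler_wsqrtr // lerDl sqr_ge0. Qed.

Lemma dot_perp_le x : normc (dot p x +i* dot r x) <= enorm x.
Proof.
rewrite enorm_frame -[X in X <= _]ger0_norm ?normc_ge0 // -sqrtr_sqr.
by rewrite ler_wsqrtr // lerDr sqr_ge0.
Qed.

Lemma dot_p_le x : `|dot p x| <= enorm x.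
Proof.
apply: le_trans (dot_perp_le x).
exact: (@Re_le_normc R (Complex (dot p x) (dot r x))).
Qed.

Lemma dot_r_le x : `|dot r x| <= enorm x.
Proof.
apply: le_trans (dot_perp_le x).
exact: (@Im_le_normc R (Complex (dot p x) (dot r x))).
Qed.

Lemma enorm_b : enorm b = 1.
Proof. by rewrite -[LHS]ger0_norm ?enorm_ge0 // -sqrtr_sqr enorm_sqr (frame_bb fr) sqrtr1. Qed.
Lemma enorm_p : enorm p = 1.
Proof. by rewrite -[LHS]ger0_norm ?enorm_ge0 // -sqrtr_sqr enorm_sqr (frame_pp fr) sqrtr1. Qed.
Lemma enorm_r : enorm r = 1.
Proof. by rewrite -[LHS]ger0_norm ?enorm_ge0 // -sqrtr_sqr enorm_sqr (frame_rr fr) sqrtr1. Qed.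

Hypothesis B_gt0 : 0 < enorm B.

Lemma Ppar_mul x : Ppar B *m x = dot b x *: b.
Proof.
have Bx : B^T *m x = (enorm B * dot b x)%:M.
  apply/matrixP => i j; rewrite !ord1 [RHS]mxE mulr1n mxE.
  rewrite /dot mulr_sumr; apply: eq_bigr => k _.
  by rewrite mxE {1}(frame_axis fr) mxE mulrA.
rewrite /Ppar -scalemxAl -mulmxA Bx mul_mx_scalar {3}(frame_axis fr) !scalerA.
by congr (_ *: _); field; rewrite gt_eqF.
Qed.

Lemma enorm_Ppar x : enorm (Ppar B *m x) = `|dot b x|.
Proof.
rewrite Ppar_mul -[LHS]ger0_norm ?enorm_ge0 // -sqrtr_sqr enorm_sqr.
by rewrite dotZr [dot (_ *: _) b]dotC dotZr (frame_bb fr) mulr1 -expr2 sqrtr_sqr.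
Qed.

Lemma enorm_Pperp x : enorm (Pperp B *m x) = normc (dot p x +i* dot r x).
Proof.
have -> : Pperp B *m x = dot p x *: p + dot r x *: r.
  rewrite /Pperp mulmxBl mul1mx Ppar_mul {1}[x]frame_decomp.
  by apply: (addIr (dot b x *: b)); rewrite subrK -addrA addrC.
rewrite enorm_frame !(dotDr, dotZr) [dot r p]dotC.
rewrite (frame_pp fr) (frame_rr fr) (frame_bp fr) (frame_br fr) (frame_pr fr).
by rewrite !(mulr0, mulr1, addr0, add0r) expr0n add0r sqrtr_sqr ger0_norm ?normc_ge0.
Qed.

End InFrame.
End Space.

(** * Functions of normal matrices on eigenvectors *)

Section MatrixFunctions.
Context {R : realType} (n : nat).
Local Notation C := R[i].
Implicit Types (A : 'M[C]_n) (z : C) (g : C -> C) (x : 'cV[C]_n) (L : 'rV[C]_n).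

(** In a diagonalizing basis an eigenvector is supported on the coordinates where
    the diagonal entry equals its eigenvalue, so g acts on it as the number g z. *)
Lemma mxfun_left A g z L : A \is normalmx ->
  L *m A = z *: L -> L *m mxfun g A = g z *: L.
Proof.
move=> /orthomx_spectralP; rewrite /mxfun.
have := spectral_unit A; move: (spectralmx A) (spectral_diag A) => P D Pu defA eig.
have eigD : L *m invmx P *m diag_mx D = z *: (L *m invmx P).
  by rewrite scalemxAl -eig defA !mulmxA mulmxK.
rewrite !mulmxA (_ : _ *m diag_mx _ = g z *: (L *m invmx P)).
  by rewrite -scalemxAl mulmxKV.
apply/rowP => j; move/rowP: eigD => /(_ j); rewrite !mul_mx_diag !mxE.
have [->|w0] := eqVneq ((\sum_k L 0 k * invmx P k j)) 0; first by rewrite !(mulr0, mul0r).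
by rewrite mulrC => /(mulIf w0) ->; rewrite mulrC.
Qed.

Lemma mxfun_right A g z x : A \is normalmx ->
  A *m x = z *: x -> mxfun g A *m x = g z *: x.
Proof.
move=> /orthomx_spectralP; rewrite /mxfun.
have := spectral_unit A; move: (spectralmx A) (spectral_diag A) => P D Pu defA eig.
have eigD : diag_mx D *m (P *m x) = z *: (P *m x).
  by rewrite scalemxAr -eig defA -!mulmxA mulKVmx.
rewrite -!mulmxA (_ : diag_mx _ *m _ = g z *: (P *m x)).
  by rewrite -scalemxAr mulKmx.
apply/colP => j; move/colP: eigD => /(_ j); rewrite !mul_diag_mx !mxE.
have [->|w0] := eqVneq ((\sum_k P j k * x k 0)) 0; first by rewrite !mulr0.
by move=> /(mulIf w0) ->.
Qed.

Lemma cenorm_ge0 x : 0 <= cenorm x.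
Proof. exact: sqrtr_ge0. Qed.

Lemma cenormZ z x : cenorm (z *: x) = normc z * cenorm x.
Proof.
rewrite /cenorm -[normc z]ger0_norm ?normc_ge0 // -sqrtr_sqr -sqrtrM ?sqr_ge0 //.
congr Num.sqrt; rewrite mulr_sumr; apply: eq_bigr => i _.
by rewrite mxE normcM exprMn.
Qed.

Lemma normc_le_cenorm x i : normc (x i 0) <= cenorm x.
Proof.
rewrite -[X in X <= _]ger0_norm ?normc_ge0 // -sqrtr_sqr ler_wsqrtr //.
by rewrite (bigD1 i) //= lerDl sumr_ge0 // => j _; rewrite sqr_ge0.
Qed.

Lemma cenorm_eq0 x : cenorm x = 0 -> x = 0.
Proof.
move=> x0; apply/colP => i; rewrite mxE; apply: eq0_normc.
by apply/le_anti; rewrite normc_ge0 -x0 normc_le_cenorm.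
Qed.

Lemma cenorm_le_sum x : cenorm x <= \sum_i normc (x i 0).
Proof.
have S0 : 0 <= \sum_i normc (x i 0) by rewrite sumr_ge0 // => i _; rewrite normc_ge0.
rewrite -[leRHS]ger0_norm // -sqrtr_sqr ler_wsqrtr // expr2 mulr_suml.
apply: ler_sum => i _; rewrite expr2 ler_wpM2l ?normc_ge0 //.
by rewrite (bigD1 i) //= lerDl sumr_ge0 // => j _; rewrite normc_ge0.
Qed.

(** The crude entrywise bound makes the set of values bounded, hence its supremum
    meaningful. *)
Lemma opnorm_bound A x : cenorm x <= 1 -> cenorm (A *m x) <= opnorm A.
Proof.
move=> x1; apply: ub_le_sup; last by exists x.
exists (\sum_i \sum_j normc (A i j)) => _ [y y1 <-].
apply: le_trans (cenorm_le_sum _) _; apply: ler_sum => i _; rewrite mxE.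
elim/big_rec2 : _ => [|j a b _ IH]; first by rewrite normc0.
apply: le_trans (normcD _ _) (lerD _ IH); rewrite normcM ler_piMr ?normc_ge0 //.
exact: le_trans (normc_le_cenorm _ _) y1.
Qed.

Lemma eigenvalue_le_opnorm A z x : x != 0 -> A *m x = z *: x -> normc z <= opnorm A.
Proof.
move=> x0 eig; have c0 : cenorm x != 0.
  by apply: contra_neq x0 => /cenorm_eq0.
have unit : normc (cenorm x)^-1%:C * cenorm x = 1.
  by rewrite normc_real ger0_norm ?invr_ge0 ?cenorm_ge0 // mulVf.
have := @opnorm_bound A ((cenorm x)^-1%:C *: x); rewrite cenormZ unit lexx => /(_ isT).
by rewrite -scalemxAr eig !cenormZ mulrCA unit mulr1.
Qed.

End MatrixFunctions.

(** * Scalar form of the integrator *)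

Section Spectrum.
Context {R : realType}.
Local Notation C := R[i].
Implicit Types (B w v x p r : 'cV[R]_3) (tau c be : R) (g : C -> C).

Lemma dot_delta n (x : 'cV[R]_n) i : dot (delta_mx i 0) x = x i 0.
Proof.
rewrite /dot (bigD1 i) //= mxE !eqxx mul1r big1 ?addr0 // => j ji.
by rewrite mxE (negPf ji) mul0r.
Qed.

Lemma dotNl n (u x : 'cV[R]_n) : dot (- u) x = - dot u x.
Proof. by rewrite /dot -sumrN; apply: eq_bigr => i _; rewrite mxE mulNr. Qed.

Lemma dot_cross_anti B v w : dot v (crossv w B) = - dot w (crossv v B).
Proof.
rewrite !dotE; have [-> -> ->] := crossvE w B; have [-> -> ->] := crossvE v B.
by ring.
Qed.

Lemma Bmx_tr B : (Bmx B)^T = - Bmx B.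
Proof.
have entry i j : Bmx B i j = dot (delta_mx i 0) (crossv (delta_mx j 0) B).
  by rewrite mxE dot_delta.
by apply/matrixP => i j; rewrite mxE [RHS]mxE !entry dot_cross_anti.
Qed.

Lemma toC_B_tr tau B : (toC (tau *: Bmx B))^T = - toC (tau *: Bmx B).
Proof. by rewrite /toC map_trmx linearZ /= Bmx_tr scalerN map_mxN. Qed.

Lemma toC_B_normal tau B : toC (tau *: Bmx B) \is normalmx.
Proof.
apply/normalmxP; have -> : map_mx Num.conj ((toC (tau *: Bmx B))^T) = - toC (tau *: Bmx B).
  rewrite toC_B_tr; apply/matrixP => i j; rewrite !mxE.
  by rewrite -[X in - X]/((_)%:C) -rmorphN; apply: conj_Creal; rewrite complex_real.
by rewrite mulmxN mulNmx.
Qed.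

Definition functional w1 w2 : 'rV[C]_3 := \row_j (w1 j 0 +i* w2 j 0).

Lemma functionalE w1 w2 x :
  functional w1 w2 *m toC x = (dot w1 x +i* dot w2 x)%:M.
Proof.
apply/matrixP => i j; rewrite !ord1 !mxE mulr1n /dot.
elim/big_ind3: _ => [|a a' a'' b b' b'' -> -> //|k _]; first by [].
by rewrite !mxE /=; apply: complex_eq => /=; ring.
Qed.

(** The hypotheses say that (w1 + i w2).(v x B) = i c (w1 + i w2).v; they cover
    p + i r with c = |B|, p - i r with c = - |B|, and b with w2 = 0 and c = 0. *)
Lemma functional_eigen tau B w1 w2 c :
  (forall v, dot w1 (crossv v B) = - (c * dot w2 v)) ->
  (forall v, dot w2 (crossv v B) = c * dot w1 v) ->
  functional w1 w2 *m toC (tau *: Bmx B) = (0 +i* (c * tau)) *: functional w1 w2.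
Proof.
move=> H1 H2; apply/rowP => j.
have -> : (functional w1 w2 *m toC (tau *: Bmx B)) 0 j =
    (functional w1 w2 *m toC (tau *: Bmx B *m delta_mx j (0 : 'I_1))) 0 0.
  by rewrite /toC map_mxM mulmxA map_delta_mx -colE [RHS]mxE.
rewrite -scalemxAl Bmx_mul functionalE !dotZr H1 H2 ![dot _ (delta_mx _ _)]dotC !dot_delta.
by rewrite !mxE mulr1n; apply: complex_eq => /=; ring.
Qed.

(** The matrix is skew-symmetric, so the transpose of the left eigenvector
    w1 - i w2, of eigenvalue - i c tau, is a right eigenvector of eigenvalue
    i c tau. *)
Lemma filter_bound tau B w1 w2 c g : dot w1 w1 = 1 ->
  (forall v, dot w1 (crossv v B) = - (c * dot w2 v)) ->
  (forall v, dot w2 (crossv v B) = c * dot w1 v) ->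
  normc (g (0 +i* (c * tau))) <= opnorm (funB g tau B).
Proof.
move=> w11 H1 H2.
have eig : toC (tau *: Bmx B) *m (functional w1 (- w2))^T =
    (0 +i* (c * tau)) *: (functional w1 (- w2))^T.
  rewrite -[toC _]opprK -toC_B_tr mulNmx -trmx_mul.
  rewrite (@functional_eigen tau B w1 (- w2) (- c)).
  - by rewrite linearZ /= -scaleNr; congr (_ *: _); apply: complex_eq => /=; ring.
  - by move=> v; rewrite H1 dotNl; ring.
  - by move=> v; rewrite dotNl H2; ring.
apply: (@eigenvalue_le_opnorm _ _ _ _ (functional w1 (- w2))^T).
  apply/eqP => /(congr1 trmx); rewrite trmxK trmx0 => /rowP w0.
  suff : dot w1 w1 = 0 by rewrite w11 => /eqP; rewrite oner_eq0.
  rewrite /dot big1 // => i _; have := w0 i; rewrite !mxE => -[-> _].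
  by rewrite mulr0.
by apply: mxfun_right => //; exact: toC_B_normal.
Qed.

Lemma functional_funB tau B w1 w2 c g x :
  (forall v, dot w1 (crossv v B) = - (c * dot w2 v)) ->
  (forall v, dot w2 (crossv v B) = c * dot w1 v) ->
  (functional w1 w2 *m (funB g tau B *m toC x)) 0 0 =
    g (0 +i* (c * tau)) * (dot w1 x +i* dot w2 x).
Proof.
move=> H1 H2; rewrite mulmxA (mxfun_left g (toC_B_normal _ _) (functional_eigen tau H1 H2)).
by rewrite -scalemxAl functionalE !mxE mulr1n.
Qed.

Lemma integrator_step_functional (f : filters R) tau B E q0 v0 q1 v1 w1 w2 c
    (z := 0 +i* (c * tau)) (ev := fun x => dot w1 x +i* dot w2 x : C) :
  (forall v, dot w1 (crossv v B) = - (c * dot w2 v)) ->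
  (forall v, dot w2 (crossv v B) = c * dot w1 v) ->
  integrator_step f tau B E q0 v0 q1 v1 ->
  ev q1 = ev q0 + (tau / 2)%:C * (psim f z * ev v0 + psip f z * ev v1)
    + (tau ^+ 2 / 4)%:C * (chim f z * ev (E q0) + chip f z * ev (E q1)) /\
  ev v1 = cexp z * ev v0
    + (tau / 2)%:C * (phim f z * ev (E q0) + phip f z * ev (E q1)).
Proof.
move=> H1 H2 [Hq Hv].
pose phi (X : 'cV[C]_3) := (functional w1 w2 *m X) 0 0.
have phiD X Y : phi (X + Y) = phi X + phi Y by rewrite /phi mulmxDr mxE.
have phiZ s X : phi (s *: X) = s * phi X by rewrite /phi -scalemxAr mxE.
have phiE x : phi (toC x) = ev x by rewrite /phi functionalE mxE mulr1n.
have phiF g x : phi (funB g tau B *m toC x) = g z * ev x := functional_funB tau g x H1 H2.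
split; first by rewrite -phiE Hq !(phiD, phiZ) !phiE !phiF.
by rewrite -phiE Hv !(phiD, phiZ) !phiF.
Qed.

End Spectrum.

(** * Filter functions on the spectrum *)

Section Filters.
Context {R : realType}.
Local Notation C := R[i].
Implicit Types (z : C) (th : R).

Lemma evolves_integral (F f : R -> R) : evolves 1 F f ->
  {within `[0, 1], continuous f} ->
  \int[lebesgue_measure]_(s in `[0%R, 1%R]) f s = F 1 - F 0.
Proof.
move=> [cF dF] cf; rewrite /Rintegral (continuous_FTC2 ltr01 cf (F := F)) //.
  have [_ F0 F1] := (continuous_within_itvP F ltr01).1 cF.
  by split=> // t; rewrite in_itv /= => /dF H; apply: ex_derive.
by move=> t; rewrite in_itv /= => /dF H; rewrite derive1E; apply: derive_val.
Qed.

Lemma varphi1_imag th : th != 0 ->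
  varphi 1 (0 +i* th) = (cexp (0 +i* th) - 1) / (0 +i* th).
Proof.
move=> th0; rewrite /varphi /cint01.
have E s : cexp ((1 - s)%:C * (0 +i* th)) * (s ^+ 0 / 0`!%:R)%:C =
    cos (- th * (s - 1)) +i* sin (- th * (s - 1)).
  rewrite (_ : (1 - s)%:C * (0 +i* th) = 0 +i* (- th * (s - 1))); last first.
    by apply: complex_eq => /=; ring.
  by rewrite cexp_imag expr0 divr1 mulr1.
under eq_Rintegral do rewrite E /=.
under [X in _ +i* X]eq_Rintegral do rewrite E /=.
have HC := evolves_cos 1 (- th) 1; have HS := evolves_sin 1 (- th) 1.
have thN0 : - th != 0 by rewrite oppr_eq0.
have HC' := evolvesZ (th^-1) HC; have HS' := evolvesZ (- th)^-1 HS.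
rewrite (evolves_integral (evolves_ext HS' _) HC.1); last by move=> t; rewrite mulrA mulVf ?mul1r.
rewrite (evolves_integral (evolves_ext HC' _) HS.1); last by move=> t; field.
rewrite divc_imag // cexp_imag subrr mulr0 sub0r mulrN1 opprK cos0 sin0.
by apply: complex_eq => /=; field.
Qed.

Lemma varphi1_0 : varphi 1 (0 : C) = 1.
Proof.
rewrite /varphi /cint01.
have E s : cexp ((1 - s)%:C * (0 : C)) * (s ^+ 0 / 0`!%:R)%:C = 1.
  by rewrite mulr0 expr0 divr1 mulr1 (cexp_imag 0) cos0 sin0.
under eq_Rintegral do rewrite E /=.
under [X in _ +i* X]eq_Rintegral do rewrite E /=.
have H1 := evolves_id (1 : R); have H0 c := evolves_cst (1 : R) c.
rewrite (evolves_integral H1 (H0 1).1) (evolves_integral (H0 0) (H0 0).1).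
by rewrite !subr0.
Qed.

Lemma varphi2_0 : varphi 2 (0 : C) = (1 / 2)%:C.
Proof.
rewrite /varphi /cint01.
have E s : cexp ((1 - s)%:C * (0 : C)) * (s ^+ 1 / 1`!%:R)%:C = s%:C.
  by rewrite mulr0 expr1 divr1 (cexp_imag 0) cos0 sin0 mul1r.
under eq_Rintegral do rewrite E /=.
under [X in _ +i* X]eq_Rintegral do rewrite E /=.
have H1 := evolves_id (1 : R); have H0 c := evolves_cst (1 : R) c.
have H2 : evolves 1 (fun s : R => 1 / 2 * (s * s)) (fun s => s).
  by have := evolvesZ (1 / 2) (evolvesM H1 H1); move/evolves_ext; apply=> t; field.
rewrite (evolves_integral H2 H1.1) (evolves_integral (H0 0) (H0 0).1).
by apply: complex_eq => /=; ring.
Qed.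

Lemma half_imag th : (0 +i* th) / 2 = 0 +i* (th / 2) :> C.
Proof.
apply: (mulIf (_ : (2 : C) != 0)); first by rewrite pnatr_eq0.
by rewrite divfK ?pnatr_eq0 // mulr_natr mulr2n; apply: complex_eq => /=; field.
Qed.

(** With w = e^(z/2) all the functions involved are rational in z and w, and the
    three conditions are solved for phi_- + phi_+, psi_- and chi_- + chi_+.  The
    last identity is the one that makes the guiding center law exact for a
    constant force: its right-hand side is varphi_2(z). *)
Lemma filter_order_conditions (f : filters R) th (z := 0 +i* th : C) : th != 0 ->
  Phi0 f z = 0 -> Psi0 f z = 0 -> Psi1 f z = 0 ->
  [/\ (phim f z + phip f z) / 2 = (cexp z - 1) / z,
      (psim f z + psip f z * cexp z) / 2 = (cexp z - 1) / z &
      (chim f z + chip f z + psip f z * (phim f z + phip f z)) / 4 =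
        ((cexp z - 1) / z - 1) / z].
Proof.
move=> th0; have z0 : z != 0 by rewrite imag_neq0.
have z20 : z / 2 != 0 by rewrite mulf_neq0 ?invr_eq0 ?pnatr_eq0.
have h0 : th / 2 != 0 by rewrite mulf_neq0 ?invr_eq0 ?pnatr_eq0.
rewrite /Phi0 /Psi0 /Psi1 /sinch /psi1sinh (negPf z20) /csinh.
have -> : varphi 1 (- (z / 2)) = (cexp (- (z / 2)) - 1) / (- (z / 2)).
  have -> : - (z / 2) = 0 +i* (- (th / 2)).
    by rewrite half_imag; apply: complex_eq => /=; rewrite ?oppr0.
  by rewrite varphi1_imag ?oppr_eq0.
have -> : varphi 1 (z / 2) = (cexp (z / 2) - 1) / (z / 2) by rewrite half_imag varphi1_imag.
rewrite varphi1_imag // -/z.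
have ww : cexp z = cexp (z / 2) * cexp (z / 2).
  rewrite half_imag !cexp_imag {1 2}(_ : th = th / 2 + th / 2); last by field.
  by rewrite cosD sinD; apply: complex_eq => /=; ring.
have w0 : cexp (z / 2) != 0.
  apply/eqP => w0; have := normc_cexp_imag (th / 2).
  by rewrite -half_imag -/z w0 normc0 => /eqP; rewrite eq_sym oner_eq0.
have wV : cexp (- (z / 2)) = (cexp (z / 2))^-1.
  apply: (mulIf w0); rewrite mulVf //.
  have -> : - (z / 2) = 0 +i* (- (th / 2)).
    by rewrite half_imag; apply: complex_eq => /=; rewrite ?oppr0.
  rewrite half_imag !cexp_imag cosN sinN; have := cos2Dsin2 (th / 2).
  by move=> cs; apply: complex_eq => /=; [rewrite -[RHS]cs; ring|ring].
rewrite ww wV; move: (cexp (z / 2)) w0 => w w0 H0 H1 H2; clear ww wV z20; clearbody z.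
have p0 : phim f z + phip f z = 2 * ((w * w - 1) / z).
  by move/eqP: H0; rewrite subr_eq0 => /eqP ->; field.
have p1 : psim f z = 2 * ((w * w - 1) / z) - psip f z * (w * w).
  rewrite (_ : psim f z = 2 * ((w * w - 1) / z) - psip f z * (w * w) - 2 * w *
    ((w - w^-1) / 2 / (z / 2) - (psim f z + psip f z * (w * w)) / w / 2)).
    by rewrite H1 mulr0 subr0.
  by field; rewrite w0.
split.
- by rewrite p0; field.
- by rewrite p1; field.
- rewrite p0.
  have -> : chim f z + chip f z = 4 * (((w - w^-1) / 2 - z / 2) / (z / 2) ^+ 2 / 2 -
   (psip f z * ((w - 1) / (z / 2)) - psim f z * ((w^-1 - 1) / - (z / 2))) / 4).
    by move/eqP: H2; rewrite subr_eq0 => /eqP ->; field.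
  by rewrite p1; field; rewrite z0 w0.
Qed.

(** At 0 the conditions determine the trapezoidal rule for the velocity, and a
    position update that is exact for a constant force. *)
Lemma filter_zero_conditions (f : filters R) :
  Phi0 f 0 = 0 -> Phi1 f 0 = 0 -> Psi0 f 0 = 0 -> Psi1 f 0 = 0 ->
  [/\ phim f 0 = 1, phip f 0 = 1, (psim f 0 + psip f 0) / 2 = 1 &
      (chim f 0 + chip f 0) / 4 + psip f 0 / 2 = 1 / 2].
Proof.
rewrite /Phi0 /Phi1 /Psi0 /Psi1 /sinch /psi1sinh mul0r oppr0 eqxx varphi1_0 varphi2_0.
have -> : cexp (0 : C) = 1 by rewrite (cexp_imag 0) cos0 sin0.
have -> : (1 / 2)%:C = 1 / 2 :> C by rewrite fmorph_div rmorph1 rmorph_nat.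
move: (phim f 0) (phip f 0) (psim f 0) (psip f 0) (chim f 0) (chip f 0).
move=> m p sm sp cm cp H0 H1 H2 H3.
have e1 : (sm + sp) / 2 = 1.
  rewrite (_ : (sm + sp) / 2 = 1 - (1 - (sm + sp * 1) * 1 / 2)).
    by rewrite H2 subr0.
  by field.
split=> //.
- rewrite (_ : m = 1 - (1 - (p + m) / 2) + 2 * (1 / 2 - 1 / 2 - (p - m) / 4)).
    by rewrite H0 H1 subr0 mulr0 addr0.
  by field.
- rewrite (_ : p = 1 - (1 - (p + m) / 2) - 2 * (1 / 2 - 1 / 2 - (p - m) / 4)).
    by rewrite H0 H1 !subr0 mulr0 subr0.
  by field.
- rewrite (_ : (cm + cp) / 4 + sp / 2 =
    (sm + sp) / 2 / 2 - (0 / 2 - (sp * 1 - sm * 1) / 4 - (cm + cp) / 4)).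
    by rewrite H3 e1 subr0.
  by field.
Qed.

(** Modulo 2 pi, the angle th stays away from 0 by the smaller of vt and vt0: the
    bound vt0 on th itself takes the place of the condition for k = 0. *)
Lemma nonresonance (vt vt0 th : R) : 0 < vt < pi -> 0 < vt0 -> vt0 <= th ->
  (forall k : int, k != 0 -> vt <= `|th - 2 * pi * k%:~R|) ->
  1 - cos (Num.min vt vt0) <= normc (cexp (0 +i* th) - 1).
Proof.
move=> /andP[vt_gt0 vt_ltpi] vt0_gt0 th_ge nonres.
set eta := Num.min vt vt0.
have pi0 : 0 < pi :> R := pi_gt0 R.
have eta_gt0 : 0 < eta by rewrite lt_min vt_gt0.
have eta_lt : eta < pi by rewrite gt_min vt_ltpi.
suff cos_le : cos th <= cos eta.
  apply: le_trans (Re_le_normc _); rewrite cexp_imag /= distrC ger0_norm.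
    by rewrite lerD2l lerN2.
  by rewrite subr_ge0 cos_le1.
have th_ge0 : 0 <= th by apply: le_trans (ltW vt0_gt0) th_ge.
have q0 : 0 <= th / (2 * pi) by rewrite divr_ge0 // mulr_ge0 // ltW.
(* k counts the full turns and r is the remaining angle; the conditions for k and
   for k + 1 bound r from below and from above. *)
pose k := Num.truncn (th / (2 * pi)); pose r := th - 2 * pi * k%:R.
have /andP[kl ku] := truncn_itv q0.
rewrite ler_pdivlMr ?mulr_gt0 // in kl; rewrite ltr_pdivrMr ?mulr_gt0 // in ku.
have -> : cos th = cos r.
  rewrite -[th](subrK (2 * pi * k%:R)) -/r.
  rewrite (_ : 2 * pi * k%:R = (pi *+ 2) *+ k) ?(periodicn (@cosD2pi R)) //.
  by rewrite -[RHS]mulr_natr -[pi *+ 2]mulr_natl.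
have r_ge0 : 0 <= r by rewrite subr_ge0 mulrC.
have r_lt : r < 2 * pi.
  rewrite ltrBlDr; apply: lt_le_trans ku _; rewrite -natr1 -/k; lra.
have eta_r : eta <= r.
  have [k0|k0] := eqVneq k 0%N; first by rewrite /r k0 mulr0 subr0 ge_min th_ge orbT.
  have := nonres k k0; rewrite -pmulrn -/r ger0_norm // => H.
  by apply: le_trans H; rewrite ge_min lexx.
have r_eta : r <= 2 * pi - eta.
  have := nonres k.+1; rewrite -pmulrn distrC ger0_norm; last first.
    by rewrite subr_ge0 ltW // mulrC.
  move=> /(_ isT) H; have : eta <= vt by rewrite ge_min lexx.
  move: H; rewrite /r -natr1; lra.
have cos_anti x : 0 <= x -> x <= pi -> eta <= x -> cos x <= cos eta.
  move=> x0 xpi etax; have Ie : eta \in `[0, pi] by rewrite in_itv /= !ltW.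
  have Ix : x \in `[0, pi] by rewrite in_itv /= x0.
  by rewrite leNgt (ltr_cos Ix Ie) -leNgt.
have [rpi|/ltW rpi] := leP r pi; first exact: cos_anti.
have -> : cos r = cos (2 * pi - r).
  by rewrite -[LHS]cosN -cosD2pi mulr_natl addrC.
by apply: cos_anti; lra.
Qed.

End Filters.

(** * The trajectory in the frame *)

Section Curves.
Context {R : realType}.
Implicit Types (c : R -> 'cV[R]_3) (w : 'cV[R]_3) (T t : R).

Lemma dot_continuous w : continuous (dot w).
Proof.
move=> x; rewrite /continuous_at (_ : dot w = fun y =>
    w 0 0 * y 0 0 + w 1 0 * y 1 0 + w 2 0 * y 2 0).
  have cx i : {for x, continuous (fun y : 'cV[R]_3 => w i 0 * y i 0)}.
    by apply: continuousM; [exact: cst_continuous|exact: coord_continuous].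
  exact: (cvgD (cvgD (cx 0) (cx 1)) (cx 2)).
by apply/funext => y; rewrite dotE.
Qed.

Lemma is_derive_dot w c t dc : is_derive t 1 c dc ->
  is_derive t 1 (fun s => dot w (c s)) (dot w dc).
Proof.
move=> [Hd <-].
have Hi i : is_derive t 1 (fun s => c s i 0) ('D_1 c t i 0).
  by rewrite (derive_mx Hd) mxE; apply: DeriveDef => //; exact: (derivable_mxP _ _ _).1 Hd i 0.
rewrite dotE (_ : (fun s => _) =
    (fun s => w 0 0 * c s 0 0 + w 1 0 * c s 1 0 + w 2 0 * c s 2 0)).
  exact: (is_deriveD (is_deriveD (is_deriveZ (w 0 0) (Hi 0)) (is_deriveZ (w 1 0) (Hi 1)))
    (is_deriveZ (w 2 0) (Hi 2))).
by apply/funext => y; rewrite dotE.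
Qed.

Lemma evolves_dot T w c dc : {within `[0, T], continuous c} ->
  (forall t, 0 < t < T -> is_derive t 1 c (dc t)) ->
  evolves T (fun t => dot w (c t)) (fun t => dot w (dc t)).
Proof.
move=> cc Hc; split=> [|t tT]; last exact/is_derive_dot/Hc.
by apply: within_continuous_comp cc => x _; exact: dot_continuous.
Qed.

Lemma is_derive_along (f : 'cV[R]_3 -> 'cV[R]_3) c t dc :
  differentiable f (c t) -> is_derive t 1 c dc ->
  is_derive t 1 (f \o c) ('D_dc f (c t)).
Proof.
move=> df [/derivable1_diffP dfc <-].
have dfcomp : differentiable (f \o c) t by exact: differentiable_comp.
apply: DeriveDef; first exact/derivable1_diffP.
by rewrite [LHS]deriveE // diff_comp // [RHS]deriveE //= deriveE.
Qed.

(** The derivative of f is evaluated only at points of the curve. *)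
Lemma evolves_along T w (f : 'cV[R]_3 -> 'cV[R]_3) (U : set 'cV[R]_3) c dc :
  (forall x, U x -> differentiable f x) -> (forall t, 0 <= t <= T -> U (c t)) ->
  {within `[0, T], continuous c} ->
  (forall t, 0 < t < T -> is_derive t 1 c (dc t)) ->
  evolves T (fun t => dot w (f (c t))) (fun t => dot w ('D_(dc t) f (c t))).
Proof.
move=> df cU cc Hc; apply: (evolves_dot w (c := f \o c)) => [|t tT].
  apply: within_continuous_comp cc => x; rewrite inE => -[t tT <-].
  by apply/differentiable_continuous/df/cU; move: tT; rewrite /= in_itv.
apply: is_derive_along; last exact: Hc.
by apply/df/cU; case/andP: tT => /ltW -> /ltW ->.
Qed.

(** The magnetic term contributes nothing along b and the rotation generator i |B|
    across; the derivative of the parallel force is expanded in the frame. *)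
Lemma lorentz_gyromotion (T M ME MV : R) (U : set 'cV[R]_3)
    (E : 'cV[R]_3 -> 'cV[R]_3) (B q0 v0 b p r : 'cV[R]_3) (q v : R -> 'cV[R]_3) :
  frame B b p r -> ME <= M -> MV <= M -> ME * MV <= M -> 0 < T ->
  Ck 2 U E -> C2_bounded ME U E -> lorentz_solution T E B q0 v0 q v ->
  (forall t, 0 <= t <= T -> U (q t)) ->
  (forall t, 0 <= t <= T -> enorm (v t) <= MV) ->
  exists g : gyromotion T M (enorm B),
    [/\ par_pos g = (fun t => dot b (q t)), par_vel g = (fun t => dot b (v t)),
        par_force g = (fun t => dot b (E (q t))),
        perp_pos g = (fun t => dot p (q t) +i* dot r (q t)) &
        perp_vel g = (fun t => dot p (v t) +i* dot r (v t)) /\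
        perp_force g = (fun t => dot p (E (q t)) +i* dot r (E (q t)))].
Proof.
move=> fr MEM MVM MEMV T0 [dE dDE] bdE [cq cv sol _ _] qU vMV.
have Hq t : 0 < t < T -> is_derive t 1 q (v t) by move=> /sol[].
have Hv t : 0 < t < T -> is_derive t 1 v (crossv (v t) B + E (q t)) by move=> /sol[].
have opened t : 0 < t < T -> 0 <= t <= T by case/andP => /ltW -> /ltW ->.
have ME0 : 0 <= ME.
  have T00 : 0 <= (0 : R) <= T by rewrite lexx ltW.
  have [h _ _] := bdE _ (qU 0 T00).
  exact: le_trans (enorm_ge0 _) h.
have bE t : 0 <= t <= T -> enorm (E (q t)) <= M.
  by move=> /qU/bdE[h _ _]; apply: le_trans h MEM.
have bDE w t : enorm w = 1 -> 0 <= t <= T -> enorm ('D_w E (q t)) <= M.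
  by move=> w1 /qU/bdE[_ h _]; apply: le_trans (h w) _; rewrite w1 mulr1.
have bDvE t : 0 <= t <= T -> enorm ('D_(v t) E (q t)) <= M.
  move=> tT; have [_ h _] := bdE _ (qU t tT); apply: le_trans (h _) _.
  by apply: le_trans MEMV; rewrite ler_wpM2l // vMV.
have bDDE w t : enorm w = 1 -> 0 <= t <= T ->
    enorm ('D_(v t) (fun y => 'D_w E y) (q t)) <= M.
  move=> w1 tT; have [_ _ h] := bdE _ (qU t tT); apply: le_trans (h _ _) _.
  by rewrite w1 mulr1; apply: le_trans MEMV; rewrite ler_wpM2l // vMV.
have Eev w := evolves_along w dE qU cq Hq.
have DEev w u := evolves_along w (dDE u).1 qU cq Hq.
have tameE w : (forall x, `|dot w x| <= enorm x) -> tame T M (fun t => dot w (E (q t))).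
  move=> Hw; exists (fun t => dot w ('D_(v t) E (q t))); split=> // t tT.
    exact: le_trans (Hw _) (bE t tT).
  exact: le_trans (Hw _) (bDvE t (opened t tT)).
have tameDE u : enorm u = 1 -> tame T M (fun t => dot b ('D_u E (q t))).
  move=> u1; exists (fun t => dot b ('D_(v t) (fun y => 'D_u E y) (q t))); split=> //.
  - by move=> t tT; apply: le_trans (dot_b_le fr _) (bDE _ _ u1 tT).
  - by move=> t tT; apply: le_trans (dot_b_le fr _) (bDDE _ _ u1 (opened t tT)).
have bv w t : (forall x, `|dot w x| <= enorm x) -> 0 <= t <= T -> `|dot w (v t)| <= M.
  by move=> Hw tT; apply: le_trans (Hw _) (le_trans (vMV t tT) MVM).
have Hgx := evolves_dot b cq Hq.
have Hgu : evolves T (fun t => dot b (v t)) (fun t => dot b (E (q t))).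
  by apply: evolves_ext (evolves_dot b cv Hv) _ => t; rewrite dotDr (frame_b_cross fr) add0r.
have HgF : evolves T (fun t => dot b (E (q t))) (fun t => dot b ('D_b E (q t)) * dot b (v t)
    + dot b ('D_p E (q t)) * dot p (v t) + dot b ('D_r E (q t)) * dot r (v t)).
  have [cE HE] := Eev b; split=> // t tT.
  rewrite (_ : _ + _ = dot b ('D_(v t) E (q t))); first exact: HE.
  have dEq := dE _ (qU t (opened t tT)).
  rewrite !deriveE // [v t in RHS](frame_decomp fr) !linearD !linearZ /= !dotDr !dotZr.
  by ring.
have Hgy1 : evolves T (fun t => dot p (v t))
    (fun t => - (enorm B * dot r (v t)) + dot p (E (q t))).
  by apply: evolves_ext (evolves_dot p cv Hv) _ => t; rewrite dotDr (frame_p_cross fr).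
have Hgy2 : evolves T (fun t => dot r (v t))
    (fun t => enorm B * dot p (v t) + dot r (E (q t))).
  by apply: evolves_ext (evolves_dot r cv Hv) _ => t; rewrite dotDr (frame_r_cross fr).
exists (Gyromotion Hgx Hgu HgF (evolves_dot p cq Hq) (evolves_dot r cq Hq) Hgy1 Hgy2
  (fun t => bv _ t (dot_b_le fr))
  (fun t tT => le_trans (dot_b_le fr _) (bE t tT))
  (fun t => bv _ t (dot_p_le fr)) (fun t => bv _ t (dot_r_le fr))
  (tameE _ (dot_p_le fr)) (tameE _ (dot_r_le fr))
  (tameDE _ (enorm_b fr)) (tameDE _ (enorm_p fr)) (tameDE _ (enorm_r fr))).
by split.
Qed.

End Curves.

(** * The integrator in the frame *)

Section ScalarSteps.
Context {R : realType}.
Local Notation C := R[i].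
Variables (f : filters R) (tau : R) (B b p r : 'cV[R]_3).
Hypotheses (tau_gt0 : 0 < tau) (B_gt0 : 0 < enorm B) (fr : frame B b p r).
Hypotheses (vPhi0 : vanishes tau B (Phi0 f)) (vPsi0 : vanishes tau B (Psi0 f))
  (vPsi1 : vanishes tau B (Psi1 f)) (Phi1_0 : Phi1 f 0 = 0).
Local Notation z := (0 +i* (enorm B * tau) : C).
Local Notation ib := (0 +i* enorm B : C).

Let mem0 : (0 : C) \in spectrum tau B. Proof. by rewrite inE eqxx. Qed.
Let memz : z \in spectrum tau B.
Proof. by rewrite !inE [enorm B * tau]mulrC eqxx orbT. Qed.

(** Inserting the velocity update into the position update leaves only the weights
    psi_+ + chi_-, psi_+ + chi_+ of the forces.  They may be complex, but the
    positions and forces are real, so the real parts satisfy the same relation. *)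
Lemma parallel_integrator_step E q0 v0 q1 v1 :
  integrator_step f tau B E q0 v0 q1 v1 ->
  dot b q1 = dot b q0 + tau * dot b v0 + tau ^+ 2 / 4 *
    (complex.Re (psip f 0 + chim f 0) * dot b (E q0)
     + complex.Re (psip f 0 + chip f 0) * dot b (E q1)) /\
  dot b v1 = dot b v0 + tau / 2 * (dot b (E q0) + dot b (E q1)).
Proof.
have dot0 x : dot (0 : 'cV[R]_3) x = 0 by rewrite dotE !mxE; ring.
have H1 v : dot b (crossv v B) = - (0 * dot 0 v) by rewrite (frame_b_cross fr) mul0r oppr0.
have H2 v : dot 0 (crossv v B) = 0 * dot b v by rewrite dot0 mul0r.
move=> /(integrator_step_functional H1 H2); rewrite !dot0 mul0r.
have [-> -> e1 e2] := filter_zero_conditions (vPhi0 mem0) Phi1_0 (vPsi0 mem0) (vPsi1 mem0).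
rewrite (_ : cexp (0 +i* 0) = 1); last by rewrite cexp_imag cos0 sin0.
rewrite !mul1r => -[Hq Hv]; split; last first.
  by move: Hv => /(congr1 (@complex.Re R)) /= ->; ring.
rewrite Hv in Hq; move/(congr1 (@complex.Re R)): Hq => /=.
have {}e1 : psim f 0 = 2 - psip f 0.
  move: (psim f 0) (psip f 0) e1 => sm sp /(congr1 ( *%R 2)).
  by rewrite mulr1 => e; rewrite -[X in X - _]e; field.
rewrite e1; case: (psip f 0) (chim f 0) (chip f 0) => [s1 s2] [m1 m2] [c1 c2] /= ->.
by field.
Qed.

Lemma parallel_weights :
  complex.Re (psip f 0 + chim f 0) + complex.Re (psip f 0 + chip f 0) = 2.
Proof.
have [_ _ _] := filter_zero_conditions (vPhi0 mem0) Phi1_0 (vPsi0 mem0) (vPsi1 mem0).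
have -> : 1 / 2 = (1 / 2)%:C :> C by rewrite fmorph_div rmorph1 rmorph_nat.
have -> : (chim f 0 + chip f 0) / 4 + psip f 0 / 2 =
   (1 / 4)%:C * (psip f 0 + chim f 0 + (psip f 0 + chip f 0)).
  by rewrite fmorph_div rmorph1 rmorph_nat; field.
move/(congr1 (@complex.Re R)).
case: (psip f 0) (chim f 0) (chip f 0) => [s1 s2] [m1 m2] [c1 c2] /=.
lra.
Qed.

Let z_factor : z = tau%:C * ib.
Proof. by apply: complex_eq => /=; ring. Qed.
Let th_neq0 : enorm B * tau != 0. Proof. by rewrite mulf_neq0 // gt_eqF. Qed.
Let ib_neq0 : ib != 0. Proof. by rewrite imag_neq0 // gt_eqF. Qed.
Let tauC_neq0 : tau%:C != 0. Proof. by rewrite fmorph_eq0 gt_eqF. Qed.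

Lemma perp_phi_sum :
  tau%:C / 2 * (phim f z + phip f z) = (cexp z - 1) / ib.
Proof.
have [H _ _] := filter_order_conditions th_neq0 (vPhi0 memz) (vPsi0 memz) (vPsi1 memz).
have -> : tau%:C / 2 * (phim f z + phip f z) = tau%:C * ((phim f z + phip f z) / 2).
  by move: (phim f z) (phip f z) => m p'; field.
rewrite H; move: (cexp z) => w; rewrite z_factor; field.
by rewrite ib_neq0 ?andbT; exact: tauC_neq0.
Qed.

Lemma perp_weights :
  tau%:C ^+ 2 / 4 * ((psip f z * phim f z + chim f z) + (psip f z * phip f z + chip f z))
  = ((cexp z - 1) / ib - tau%:C) / ib.
Proof.
have [_ _ H] := filter_order_conditions th_neq0 (vPhi0 memz) (vPsi0 memz) (vPsi1 memz).
rewrite (_ : _ * (_ + _) =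
    tau%:C ^+ 2 * ((chim f z + chip f z + psip f z * (phim f z + phip f z)) / 4)).
  rewrite H; move: (cexp z) => w; rewrite z_factor; field.
  by rewrite ib_neq0 ?andbT; exact: tauC_neq0.
by field.
Qed.

(** Inserting the velocity update into the position update combines psi_- and psi_+
    into (psi_- + psi_+ e^z) / 2 = (e^z - 1) / z. *)
Lemma perp_integrator_step E q0 v0 q1 v1 (ev := fun x => dot p x +i* dot r x : C) :
  integrator_step f tau B E q0 v0 q1 v1 ->
  ev q1 = ev q0 + (cexp z - 1) / ib * ev v0 + tau%:C ^+ 2 / 4 *
    ((psip f z * phim f z + chim f z) * ev (E q0)
     + (psip f z * phip f z + chip f z) * ev (E q1)) /\
  ev v1 = cexp z * ev v0 + tau%:C / 2 * (phim f z * ev (E q0) + phip f z * ev (E q1)).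
Proof.
have [_ H _] := filter_order_conditions th_neq0 (vPhi0 memz) (vPsi0 memz) (vPsi1 memz).
move=> /(integrator_step_functional (frame_p_cross fr) (frame_r_cross fr)).
have -> : (tau / 2)%:C = tau%:C / 2 by rewrite fmorph_div rmorph_nat.
have -> : (tau ^+ 2 / 4)%:C = tau%:C ^+ 2 / 4 by rewrite fmorph_div rmorph_nat rmorphXn.
rewrite -/(ev _) => -[Hq Hv]; split=> //; rewrite /ev in Hq Hv *.
rewrite {}Hq Hv; move: (ev v0) => V0.
have -> : (cexp z - 1) / ib = tau%:C * ((psim f z + psip f z * cexp z) / 2).
  rewrite H; move: (cexp z) => w; rewrite z_factor; field.
  by rewrite ib_neq0 ?andbT; exact: tauC_neq0.
by field.
Qed.

End ScalarSteps.

(** * Convergence *)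

Lemma compact_enorm_bound (R : realType) n (K : set 'cV[R]_n) : compact K ->
  exists m, 0 <= m /\ forall x, K x -> enorm x <= m.
Proof.
move=> /compact_bounded/pinfty_ex_gt0[m m0 Hm]; exists (n%:R * m).
split=> [|x Kx]; first by rewrite mulr_ge0 // ltW.
have entry i : `|x i 0| <= m.
  apply: le_trans (Hm x Kx); rewrite [leRHS]/Num.Def.normr /= mx_normrE.
  exact: (le_bigmax _ (fun ij : 'I_n * 'I_1 => `|x ij.1 ij.2|) (i, 0)).
have S0 : 0 <= \sum_i `|x i 0| by rewrite sumr_ge0.
apply: le_trans (_ : \sum_i `|x i 0| <= _); last first.
  by rewrite -[n in n%:R]card_ord mulr_natl -sumr_const ler_sum.
rewrite -[leRHS]ger0_norm // -sqrtr_sqr ler_wsqrtr // expr2 mulr_suml.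
apply: ler_sum => i _; rewrite -real_normK ?num_real // expr2.
by rewrite ler_wpM2l // (bigD1 i) //= lerDl sumr_ge0.
Qed.

Lemma seq_upper_bound (R : realType) (s : seq R) : exists M, all (fun x => x <= M) s.
Proof.
elim: s => [|x s [M HM]]; first by exists 0.
exists (Num.max x M); rewrite /= le_max lexx /=.
by apply: sub_all HM => y yM; rewrite le_max yM orbT.
Qed.

Theorem theorem6p5 (R : realType)
    (T vartheta vartheta0 LE CS Mf ME : R) (Kq Kv : set 'cV[R]_3)
    (T_gt0 : 0 < T)
    (vartheta_itv : 0 < vartheta < pi)
    (vartheta0_itv : 0 < vartheta0 < 1)
    (Kq_compact : compact Kq) (Kv_compact : compact Kv) :
  exists C tau0 : R, 0 < tau0 /\
  forall (E : 'cV[R]_3 -> 'cV[R]_3) (U : set 'cV[R]_3)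
         (B q0 v0 : 'cV[R]_3) (q v : R -> 'cV[R]_3)
         (tau : R) (f : filters R) (qn vn : nat -> 'cV[R]_3),
    open U -> Kq `<=` U -> Ck 2 U E -> C2_bounded ME U E ->
    lipschitz_const LE E ->
    lorentz_solution T E B q0 v0 q v ->
    (forall t, 0 <= t <= T -> Kq (q t) /\ Kv (v t)) ->
    0 < tau -> tau <= tau0 ->
    (forall k : int, k != 0 ->
       vartheta <= `|tau * enorm B - 2 * pi * k%:~R|) ->
    vartheta0 <= tau * enorm B ->
    2 * tau * (1 + T) * LE * CS < 1 ->
    vanishes tau B (Phi0 f) -> vanishes tau B (Psi0 f) ->
    vanishes tau B (Psi1 f) -> Phi1 f 0 = 0 ->
    opnorm (Smx f tau B) <= CS ->
    filters_bounded Mf f tau B ->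
    integrator_solution f tau T B E q0 v0 qn vn ->
    forall n : nat, n%:R * tau <= T ->
      [/\ enorm (q (n%:R * tau) - qn n) <= C * tau ^+ 2,
          enorm (Ppar B *m (v (n%:R * tau) - vn n)) <= C * tau ^+ 2 &
          enorm (Pperp B *m (v (n%:R * tau) - vn n)) <= C * tau].
Proof.
have [MV [MV0 HMV]] := compact_enorm_bound Kv_compact.
have /andP[vt0_gt0 _] := vartheta0_itv; have /andP[vt_gt0 vt_pi] := vartheta_itv.
pose c := 1 - cos (Num.min vartheta vartheta0).
have c_gt0 : 0 < c.
  have m0 : 0 < Num.min vartheta vartheta0 by rewrite lt_min vt_gt0.
  have mpi : Num.min vartheta vartheta0 < pi by rewrite gt_min vt_pi.
  have I0 : 0 \in `[0, pi : R] by rewrite in_itv /= lexx pi_ge0.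
  have Im : Num.min vartheta vartheta0 \in `[0, pi] by rewrite in_itv /= !ltW.
  by rewrite subr_gt0 -cos0 (ltr_cos I0 Im).
(* One parameter M bounds all the data; c^-1 is the bound for 1/|e^z - 1|. *)
have [M] := seq_upper_bound [:: 1; T; ME; MV; ME * MV; Mf; LE; vartheta0^-1; c^-1].
move=> /and5P[M_ge1 TM MEM MVM] /and5P[MEMV MfM LEM vtM] /andP[cM _].
have i0 : 0 < vartheta0^-1 by rewrite invr_gt0.
have ic : 0 < c^-1 by rewrite invr_gt0.
have M_gt0 : 0 < M := lt_le_trans ltr01 M_ge1.
have M4_gt0 : 0 < 16 * M ^+ 4 by rewrite mulr_gt0 // exprn_gt0.
exists (error_const M), (16 * M ^+ 4)^-1; split; first by rewrite invr_gt0.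
move=> E U B q0 v0 q v tau f qn vn _ KqU C2E bdE lipE sol inK tau_gt0 tau_le res vt0_le _
  vPhi0 vPsi0 vPsi1 Phi1_0 _ fbd [qn0 vn0 steps] n nT.
have B_gt0 : 0 < enorm B.
  by rewrite -(pmulr_rgt0 _ tau_gt0); apply: lt_le_trans vt0_le.
have [b [p [r fr]]] := exists_frame B_gt0.
have qU t : 0 <= t <= T -> U (q t) by move=> /inK[/KqU].
have vMV t : 0 <= t <= T -> enorm (v t) <= MV by move=> /inK[_ /HMV].
have [g [par_posE par_velE par_forceE perp_posE [perp_velE perp_forceE]]] :=
  lorentz_gyromotion fr MEM MVM MEMV T_gt0 C2E bdE sol qU vMV.
have be_inv : (enorm B)^-1 <= M * tau.
  rewrite -[leLHS]mul1r ler_pdivrMr // -mulrA.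
  have H := ler_pM (ltW i0) (ltW vt0_gt0) vtM vt0_le.
  by apply: le_trans H; rewrite mulVf // gt_eqF.
have tau_small : 16 * M ^+ 4 * tau <= 1 by rewrite mulrC -ler_pdivlMr // div1r.
have nonres : M^-1 <= normc (cexp (0 +i* (enorm B * tau)) - 1).
  apply: le_trans (_ : c <= _).
    by rewrite -[c]invrK lef_pV2 // posrE.
  by rewrite [enorm B * tau]mulrC; apply: nonresonance.
pose ev x := dot p x +i* dot r x.
have evB x y : ev x - ev y = ev (x - y) by rewrite /ev !dotBr.
have [[bsm bsp] [bcm bcp] [bfm bfp]] := fbd.
have bounded h w1 w2 k : dot w1 w1 = 1 ->
    (forall v, dot w1 (crossv v B) = - (k * dot w2 v)) ->
    (forall v, dot w2 (crossv v B) = k * dot w1 v) ->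
    opnorm (funB h tau B) <= Mf -> normc (h (0 +i* (k * tau))) <= M.
  move=> w11 H1 H2 Hb; apply: le_trans MfM; apply: le_trans Hb.
  exact: filter_bound w11 H1 H2.
have bz h := bounded h p r _ (frame_pp fr) (frame_p_cross fr) (frame_r_cross fr).
have b0 h : opnorm (funB h tau B) <= Mf -> normc (h 0) <= M.
  move=> Hb; have -> : 0 = 0 +i* (0 * tau) :> R[i] by apply: complex_eq => //=; rewrite mul0r.
  have dot0 x : dot (0 : 'cV[R]_3) x = 0 by rewrite dotE !mxE; ring.
  apply: (bounded h b 0 0 (frame_bb fr)) => // x; rewrite ?dot0 ?mul0r //.
  by rewrite (frame_b_cross fr) oppr0.
have M_le : M <= M ^+ 2 by rewrite ler_eXnr.
have weight (s x y : R[i]) : normc s <= M -> normc x <= M -> normc y <= M ->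
    normc (s * x + y) <= 2 * M ^+ 2.
  move=> Hs Hx Hy; apply: le_trans (normcD _ _) _; rewrite normcM.
  have H := ler_pM (normc_ge0 _) (normc_ge0 _) Hs Hx.
  by clear -H Hy M_le; lra.
have weight0 (s y : R[i]) : normc s <= M -> normc y <= M ->
    `|complex.Re (s + y)| <= 2 * M ^+ 2.
  move=> Hs Hy; apply: le_trans (Re_le_normc _) (le_trans (normcD _ _) _).
  by clear -Hs Hy M_le; lra.
have t0 : 0%:R * tau = 0 by rewrite mul0r.
have step j : (j < n)%N -> integrator_step f tau B E (qn j) (vn j) (qn j.+1) (vn j.+1).
  by move=> jn; apply: steps; apply: le_trans nT; rewrite ler_pM2r // ler_nat.
have [_ _ _ sq0 sv0] := sol.
have lip_err j : enorm (E (q (j%:R * tau)) - E (qn j)) <= M * enorm (q (j%:R * tau) - qn j).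
  by apply: le_trans (lipE _ _) _; rewrite ler_wpM2r ?enorm_ge0.
have par j jn := parallel_integrator_step fr vPhi0 vPsi0 vPsi1 Phi1_0 (step j jn).
have perp j jn := perp_integrator_step tau_gt0 B_gt0 fr vPhi0 vPsi0 vPsi1 (step j jn).
have [] := @scalar_errors R T M (enorm B) tau M_ge1 TM B_gt0 tau_gt0 be_inv tau_small g nonres n
  (fun j => dot b (qn j)) (fun j => dot b (vn j)) (fun j => dot b (E (qn j)))
  (fun j => ev (qn j)) (fun j => ev (vn j)) (fun j => ev (E (qn j)))
  (fun j => enorm (q (j%:R * tau) - qn j)) _ _ _ _ _ _ nT _ _ _ _
  (conj (bz _ bfm) (bz _ bfp))
  (conj (weight _ _ _ (bz _ bsp) (bz _ bfm) (bz _ bcm))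
    (weight _ _ _ (bz _ bsp) (bz _ bfp) (bz _ bcp)))
  (conj (weight0 _ _ (b0 _ bsp) (b0 _ bcm)) (weight0 _ _ (b0 _ bsp) (b0 _ bcp)))
  (perp_phi_sum tau_gt0 B_gt0 vPhi0 vPsi0 vPsi1) (perp_weights tau_gt0 B_gt0 vPhi0 vPsi0 vPsi1)
  (parallel_weights vPhi0 vPsi0 vPsi1 Phi1_0)
  (fun j jn => (par j jn).1) (fun j jn => (par j jn).2)
  (fun j jn => (perp j jn).1) (fun j jn => (perp j jn).2)
  (fun j => enorm_ge0 _).
all: rewrite ?par_posE ?par_velE ?par_forceE ?perp_posE ?perp_velE
  ?perp_forceE ?t0 ?sq0 ?sv0 ?qn0 ?vn0 //.
- by move=> j _; rewrite -dotBr; apply: le_trans (dot_b_le fr _) (lip_err j).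
- by move=> j _; rewrite evB; apply: le_trans (dot_perp_le fr _) (lip_err j).
- move=> j _; apply: le_trans (enorm_frame_le fr _) _.
  by rewrite -/(ev (q (j%:R * tau) - qn j)) -evB dotBr.
- move=> H1 H2 H3; split=> //; first by rewrite (enorm_Ppar fr B_gt0) dotBr.
  by rewrite (enorm_Pperp fr B_gt0) -/(ev (v (n%:R * tau) - vn n)) -evB.
Qed.
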